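(* Let $d\ge2$ and let $\mathcal{P}(L)$ be an $n$-element lattice point set in $[0,1)^d$. Then \[ \frac{\sigma(L)}{\sqrt d+\sigma(L)}\le D_{\mathcal{K}}\big(\mathcal{P}(L)\big)\le d\,2^{2(d+1)}\sigma(L). \] If $\sigma(L)\le1/2$, then the lower bound can be replaced by $c\,\sigma(L)$, where $c>0$ does not depend on the dimension $d$.
   Context: A $d$-dimensional lattice is $L=\{\sum_{i=1}^d k_ib_i:k_i\in\mathbb{Z}\}$ with $b_1,\dots,b_d\in\mathbb{R}^d$ linearly independent. It is an integration lattice if $\mathbb{Z}^d\subset L$, and then it generates the lattice point set $\mathcal{P}(L)=L\cap[0,1)^d$. The isotropic discrepancy of an $n$-point set $P_n\subset[0,1)^d$ is $D_{\mathcal{K}}(P_n)=\sup_{K\in\mathcal{K}}\big|\frac{\#(K\cap P_n)}{n}-\mathrm{vol}(K)\big|$, where $\mathcal{K}$ is the class of all convex sets contained in $[0,1)^d$ and $\mathrm{vol}$ is Lebesgue measure. The dual lattice is $L^\bot=\{h\in\mathbb{R}^d:\langle h,x\rangle\in\mathbb{Z}\text{ for all }x\in L\}$ and the spectral test is $\sigma(L)=1/\min\{\|h\|_2:h\in L^\bot\setminus\{0\}\}$. The constant $c$ is also independent of $L$ and $n$. *)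

(* Defs.v *)
From HB Require Import structures.
From mathcomp Require Import all_boot all_order all_algebra.
From mathcomp Require Import finmap.
From mathcomp Require Import all_classical all_reals all_analysis.

Set Implicit Arguments.
Unset Strict Implicit.
Unset Printing Implicit Defensive.
Import Order.TTheory GRing.Theory Num.Theory.
Import numFieldNormedType.Exports.

Local Open Scope classical_set_scope.
Local Open Scope ring_scope.

Lemma product_measure_sigma_finite (R : realType) (d1 d2 : measure_display)
    (T1 : measurableType d1) (T2 : measurableType d2)
    (m1 : {sigma_finite_measure set T1 -> \bar R})
    (m2 : {sigma_finite_measure set T2 -> \bar R}) :
  sigma_finite [set: T1 * T2] (m1 \x m2)%E.
Proof.
have /sigma_finiteP[F [TF ndF Foo]] := sigma_finiteT m1.
have /sigma_finiteP[G [TG ndG Goo]] := sigma_finiteT m2.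
exists (fun n => F n `*` G n).
  rewrite -setXTT TF TG; apply/seteqP; split=> -[x y]; last first.
    by move=> [n _ []/= ? ?]; split; exists n.
  move=> [/= [n _ Fnx] [k _ Gky]]; exists (maxn n k) => //; split.
    by move: x Fnx; exact/subsetPset/ndF/leq_maxl.
  by move: y Gky; exact/subsetPset/ndG/leq_maxr.
move=> k; have [? ?] := Foo k; have [? ?] := Goo k; split.
  exact: measurableX.
by rewrite product_measure1E// lte_mul_pinfty// ge0_fin_numE.
Qed.

Section product_tuple.
Context {R : realType} {d : measure_display} {T : measurableType d}.
Variable m : {sigma_finite_measure set T -> \bar R}.

Section cons.
Variable n : nat.

Definition tuple_cons (p : T * n.-tuple T) : n.+1.-tuple T :=
  [the n.+1.-tuple T of p.1 :: p.2].

Lemma measurable_tuple_cons : measurable_fun [set: T * n.-tuple T] tuple_cons.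
Proof.
apply: (@measurable_cons _ _ _ _ fst n snd).
  exact: measurable_fst.
exact: measurable_snd.
Qed.

Variable mu : {sigma_finite_measure set (n.-tuple T) -> \bar R}.

Definition product_cons : set (n.+1.-tuple T) -> \bar R :=
  pushforward (m \x mu)%E tuple_cons.

Let product_cons0 : product_cons set0 = 0%E.
Proof. by rewrite /product_cons /pushforward preimage_set0 measure0. Qed.

Let product_cons_ge0 A : (0 <= product_cons A)%E.
Proof. by rewrite /product_cons /pushforward; exact: measure_ge0. Qed.

Let product_cons_sigma_additive : semi_sigma_additive product_cons.
Proof.
move=> F mF tF mUF.
have mpre (A : set (n.+1.-tuple T)) :
    measurable A -> measurable (tuple_cons @^-1` A).
  by move=> mA; rewrite -[X in measurable X]setTI; exact: measurable_tuple_cons.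
rewrite /product_cons /pushforward preimage_bigcup.
apply: measure_semi_sigma_additive.
- by move=> k; exact: mpre.
- apply/trivIsetP => /= i j _ _ ij; rewrite -preimage_setI.
  by move/trivIsetP : tF => /(_ _ _ _ _ ij) ->//; rewrite preimage_set0.
- by rewrite -preimage_bigcup; exact: mpre.
Qed.

HB.instance Definition _ := isMeasure.Build _ _ _ product_cons
  product_cons0 product_cons_ge0 product_cons_sigma_additive.

Definition tuple_uncons (t : n.+1.-tuple T) : T * n.-tuple T :=
  (thead t, [tuple of behead t]).

Lemma tuple_consK : cancel tuple_cons tuple_uncons.
Proof. by case=> x t; congr pair; apply/val_inj. Qed.

Lemma measurable_tuple_uncons : measurable_fun [set: n.+1.-tuple T] tuple_uncons.
Proof.
apply: measurable_fun_pair; first exact: measurable_tnth.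
apply/measurable_fun_tnthP => i.
rewrite (_ : _ \o _ = fun t : n.+1.-tuple T => tnth t (lift ord0 i)).
  exact: measurable_tnth.
apply/funext => t /=; rewrite tnth_behead; congr tnth; apply/val_inj.
by rewrite /= inordK ?ltnS.
Qed.

Let product_cons_sigma_finite : sigma_finite setT product_cons.
Proof.
have [F FT Foo] := product_measure_sigma_finite m mu.
exists (fun k => tuple_uncons @^-1` F k).
  by rewrite -preimage_bigcup -FT preimage_setT.
move=> k; have [mF Fk] := Foo k; split.
  by rewrite -[X in measurable X]setTI; exact: measurable_tuple_uncons.
rewrite /product_cons /pushforward -comp_preimage (_ : _ \o _ = idfun) //.
by apply/funext => p; rewrite /= tuple_consK.
Qed.

HB.instance Definition _ := Measure_isSigmaFinite.Build _ _ _ product_cons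
  product_cons_sigma_finite.

End cons.

Let dirac_nil : {finite_measure set (0.-tuple T) -> \bar R} :=
  \d_([tuple] : 0.-tuple T).

Fixpoint product_tuple (n : nat) :
    {sigma_finite_measure set (n.-tuple T) -> \bar R} :=
  match n with
  | 0 => dirac_nil
  | n.+1 => product_cons (product_tuple n)
  end.

Lemma product_tuple_box n (A : 'I_n -> set T) :
  (forall i, measurable (A i)) ->
  product_tuple n [set t | forall i, A i (tnth t i)]
  = (\prod_(i < n) m (A i))%E.
Proof.
elim: n A => [|n IH] A mA.
  rewrite big_ord0 /= /dirac_nil /= diracE mem_set//=.
  by case.
rewrite big_ord_recl -(IH (fun i => A (lift ord0 i)))//.
rewrite -product_measure1E//; last first.
  rewrite (_ : [set t | _] =
      \bigcap_(i in [set: 'I_n]) ((fun t => tnth t i) @^-1` A (lift ord0 i))).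
    apply: fin_bigcap_measurable => // i _.
    by rewrite -[X in measurable X]setTI; exact: measurable_tnth.
  by apply/seteqP; split=> t /= At i => [_|]; exact: At.
rewrite /= /product_cons /pushforward; congr (_ \x _)%E.
apply/seteqP; split=> -[x t] /=.
  move=> At; split=> [|i]; first exact: At ord0.
  by have := At (lift ord0 i); rewrite tnthS.
by move=> [Ax At] i; case: (unliftP ord0 i) => [j|] ->//; rewrite tnthS.
Qed.

End product_tuple.

Section isotropic_discrepancy.
Context {R : realType} {d : nat}.
Implicit Types (x y h : 'rV[R]_d) (A K L P : set 'rV[R]_d).

(* A convex set need not be Borel (e.g. an open disc together with a non-Borel
   part of its boundary circle), so the volume is the outer extension of the
   product measure; it coincides with the completed Lebesgue measure on all
   Lebesgue measurable sets. *)
Definition vol A : \bar R :=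
  ((product_tuple (@lebesgue_measure R) d)^*)%mu
    [set t | A (\row_i tnth t i)].

(* The norm `|x| of the library on 'rV[R]_d is the maximum norm. *)
Definition dotv x y : R := \sum_i x 0 i * y 0 i.
Definition norm2 x : R := Num.sqrt (dotv x x).

Definition is_lattice L :=
  exists2 B : 'M[R]_d, row_free B &
    L = [set x | exists k : 'I_d -> int, x = \sum_i (k i)%:~R *: row i B].

Definition integer_points : set 'rV[R]_d :=
  [set x | forall i, x 0 i \is a Num.int].

Definition is_integration_lattice L := is_lattice L /\ integer_points `<=` L.

Definition unit_cube : set 'rV[R]_d := [set x | forall i, 0 <= x 0 i < 1].

Definition lattice_point_set L : set 'rV[R]_d := L `&` unit_cube.

Definition dual_lattice L : set 'rV[R]_d :=
  [set h | forall x, L x -> dotv h x \is a Num.int].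

(* The infimum is attained when L is a lattice and d > 0, the dual lattice
   being discrete. *)
Definition spectral_test L : R :=
  (inf [set norm2 h | h in dual_lattice L `\ 0])^-1.

Definition convex_in_cube : set (set 'rV[R]_d) :=
  [set K | @convex_set R 'rV[R]_d K /\ K `<=` unit_cube].

(* To be used with P a set of n points. *)
Definition isotropic_discrepancy n P : \bar R :=
  ereal_sup [set `|(#|` fset_set (K `&` P)|%:R / n%:R)%:E - vol K|%E
            | K in convex_in_cube].

End isotropic_discrepancy.

Lemma vol_box (R : realType) (d : nat) (a b : 'I_d -> R) :
  (forall i, a i <= b i) ->
  vol [set x | forall i, a i <= x 0 i < b i] = (\prod_i (b i - a i))%:E.
Proof.
move=> ab; rewrite /vol.
have -> : [set t : d.-tuple (measurableTypeR R) |
    [set x : 'rV[R]_d | forall i, a i <= x 0 i < b i] (\row_i tnth t i)] =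
    [set t | forall i, `[a i, b i[%classic (tnth t i)].
  by apply/seteqP; split=> t /= At i; move: (At i); rewrite /= mxE in_itv.
rewrite measurable_mu_extE; last first.
  rewrite (_ : [set t | _] =
      \bigcap_(i in [set: 'I_d])
        ((fun t : d.-tuple (measurableTypeR R) => tnth t i)
           @^-1` `[a i, b i[%classic)).
    apply: fin_bigcap_measurable => // i _.
    by rewrite -[X in measurable X]setTI; exact: measurable_tnth.
  by apply/seteqP; split=> t /= At i => [_|]; exact: At.
transitivity (\prod_(i < d) lebesgue_measure (`[a i, b i[%classic : set R))%E.
  exact: (product_tuple_box lebesgue_measure
    (A := fun i => `[a i, b i[%classic : set (measurableTypeR R))).
rewrite -prodEFin; apply: eq_bigr => i _.
rewrite lebesgue_measure_itv/= lte_fin; case: ltP => // ba.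
by have /eqP := le_anti (introT andP (conj (ab i) ba)) => /eqP ->; rewrite subrr.
Qed.

(* Main.v *)
Require Import Defs.
From mathcomp Require Import all_boot all_order all_algebra finmap.
From mathcomp Require Import all_classical all_reals all_analysis.
From mathcomp Require Import zify ring lra.

Set Implicit Arguments.
Unset Strict Implicit.
Unset Printing Implicit Defensive.
Import Order.TTheory GRing.Theory Num.Theory.

Local Open Scope classical_set_scope.
Local Open Scope card_scope.
Local Open Scope ring_scope.

(** Both bounds are obtained by counting points on lines and in slabs; below, [n]
    is the number of lattice points in the unit cube.

    The upper bound.  Let [K] be convex in the unit cube and let [c] be a vector
    of the lattice [L].  When all points of [L] are moved by a multiple of [c],
    their number in [K] changes by at most one on each line in direction [c], and
    at most [2 ^ d * n * norm2 c] of these lines meet [K] ([cnt_shift]): starting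
    from the last point in [K], each such line carries about [1 / norm2 c] further
    points in a box of side 2, which contains only [2 ^ d * n] points in all.  If
    vectors [c_1, ..., c_k] of [L] span the space, every translate of [L]
    therefore has the same number of points in [K] up to
    [2 ^ d * n * \sum_j norm2 c_j].  A fine grid [M^-1 Z^d] is a union of
    translates of [L], so the proportion of the points of [L] that lie in [K]
    is close to the proportion of grid points in [K] ([equidistribution]), and
    the latter tends to the volume of [K] ([vol_grid], by the same line
    argument).  It remains to find short spanning vectors.  Korkine-Zolotarev
    reduction gives spanning vectors [c_j] of [L] and a single nonzero dual vector
    [h] with [norm2 c_j * norm2 h <= (4/3) ^ (d/2)] ([dual_reduction]), while
    [(norm2 h)^-1] is at most the spectral test.  This yields the bound
    [d * 4 ^ d] times the spectral test, which is more than is claimed.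

    The lower bounds.  Let [h] be a nonzero dual vector.  Its coordinates are
    integers since [Z^d] is contained in [L].  The lattice points lie on the
    hyperplanes [dotv h x = k], [k] an integer, hence an open slab between two
    consecutive hyperplanes is a convex set without lattice points and its volume
    bounds the discrepancy from below.  On the cube [dotv h] takes values in an
    interval with integer end points of length
    [\sum_i `|h 0 i| <= sqrt d * norm2 h], so some slab has volume at least
    [(sqrt d * norm2 h)^-1] ([inv_sqrt_dual_le]).  For the bound that is free of the
    dimension, [dotv h] has variance at most [(norm2 h)^2 / 4], so on three
    quarters of the cube it differs from its mean by at most [norm2 h]; this part
    is covered by at most [4 * norm2 h] slabs ([inv_dual_le]). *)

(** * Counting points of finite sets *)

Definition cnt (T : choiceType) (A : set T) : nat := #|` fset_set A|.

(** Holds for infinite sets too, for which [fset_set] is empty. *)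
Lemma mem_fset_setW (T : choiceType) (A : set T) x : x \in fset_set A -> A x.
Proof.
rewrite /fset_set; case: pselect => [finA|]; last by rewrite in_fset0.
by case: cid => B /= -> .
Qed.

Lemma finite_set_inj (T U : Type) (A : set T) (B : set U) (f : T -> U) :
  finite_set B -> (forall x, A x -> B (f x)) ->
  (forall x y, A x -> A y -> f x = f y -> x = y) -> finite_set A.
Proof.
move=> finB fAB finj; have AfA : A #= f @` A.
  by rewrite card_eq_sym; apply: inj_card_eq => x y; rewrite !inE; exact: finj.
rewrite (eq_finite_set AfA); apply: sub_finite_set finB.
by move=> _ [x Ax <-]; exact: fAB.
Qed.

Lemma leq_cnt (T U : choiceType) (A : set T) (B : set U) (f : T -> U) :
  finite_set B -> (forall x, A x -> B (f x)) ->
  (forall x y, A x -> A y -> f x = f y -> x = y) -> (cnt A <= cnt B)%N.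
Proof.
move=> finB fAB finj; rewrite /cnt.
have <- : #|` (f @` fset_set A)%fset| = #|` fset_set A|.
  apply/eqP/card_in_imfsetP => x y /mem_fset_setW Ax /mem_fset_setW Ay.
  exact: finj.
apply: fsubset_leq_card; apply/fsubsetP => y /imfsetP[x /= /mem_fset_setW Ax ->].
by rewrite in_fset_set// inE; exact: fAB.
Qed.

Lemma cnt_le (T : choiceType) (A B : set T) :
  finite_set B -> A `<=` B -> (cnt A <= cnt B)%N.
Proof. by move=> finB AB; apply: (@leq_cnt _ _ _ _ id). Qed.

Lemma cntU (T : choiceType) (A B : set T) :
  finite_set A -> finite_set B -> (cnt (A `|` B) <= cnt A + cnt B)%N.
Proof. by move=> fA fB; rewrite /cnt fset_setU// -cardfsUI leq_addr. Qed.

Lemma cnt_range (U : choiceType) (F : finType) (f : F -> U) :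
  injective f -> cnt (range f) = #|F|.
Proof.
move=> finj; rewrite /cnt fset_set_image; last exact: finite_finset.
rewrite card_imfset//=.
have -> : fset_set [set: F] = [fset x in F]%fset.
  apply/fsetP => x; rewrite in_fset_set ?inE//; last exact: finite_finset.
  exact: mem_setT.
by rewrite card_imfset //= -cardE.
Qed.

Lemma cntX (T : choiceType) (F : finType) (A : set T) : finite_set A ->
  cnt (A `*` [set: F]) = (cnt A * #|F|)%N.
Proof.
move=> finA; pose f (p : fset_set A * F) := (val p.1, p.2).
have <- : range f = A `*` [set: F].
  apply/seteqP; split=> [_ [[a b] _ <-]|[a b] [/= Aa _]].
    by split => //=; apply: mem_fset_setW; exact: valP.
  have aA : a \in fset_set A by rewrite in_fset_set// inE.
  by exists ([` aA]%fset, b).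
rewrite cnt_range; first by rewrite card_prod -cardfE.
by move=> [a b] [a' b'] [/val_inj -> ->].
Qed.

(** * Convexity and periodic groups *)

Lemma conv_itv (R : realType) (a b l u v : R) :
  u <= a <= v -> u <= b <= v -> 0 <= l <= 1 ->
  u <= l * a + (1 - l) * b <= v.
Proof.
move=> /andP[ua av] /andP[ub bv] /andP[l0]; rewrite -subr_ge0 => l1.
have := mulr_ge0 l0 (_ : 0 <= a - u); have := mulr_ge0 l0 (_ : 0 <= v - a).
have := mulr_ge0 l1 (_ : 0 <= b - u); have := mulr_ge0 l1 (_ : 0 <= v - b).
rewrite !subr_ge0 => /(_ bv) h1 /(_ ub) h2 /(_ av) h3 /(_ ua) h4.
by apply/andP; split; lra.
Qed.

Lemma conv_lt (R : realType) (a b l v : R) : a < v -> b < v -> 0 <= l <= 1 ->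
  l * a + (1 - l) * b < v.
Proof.
move=> av bv /andP[l0]; rewrite -subr_ge0 => l1.
have [->|lN0] := eqVneq l 0; first by rewrite mul0r add0r subr0 mul1r.
have lgt : 0 < l by rewrite lt_neqAle eq_sym lN0.
have := mulr_gt0 lgt (_ : 0 < v - a); have := mulr_ge0 l1 (_ : 0 <= v - b).
by rewrite subr_gt0 subr_ge0 => /(_ (ltW bv)) h1 /(_ av) h2; lra.
Qed.

Section periodic.
Context {R : realType} {d : nat}.
Implicit Types (A K L : set 'rV[R]_d) (x y b t lo : 'rV[R]_d) (s : nat).

(** Convexity with a bare scalar as weight; [convex_in_cube_cvx] and
    [cvx_convex] relate it to [convex_set]. *)
Definition cvx A := forall x y (l : R), A x -> A y -> 0 <= l <= 1 ->
  A (l *: x + (1 - l) *: y).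

(** What the counting arguments use of an integration lattice.  The grids
    [M^-1 Z^d] are periodic groups as well, so that the same lemmas serve to
    compare the lattice with its translates and to approximate volumes. *)
Definition periodic_group L :=
  [/\ L 0, forall x y, L x -> L y -> L (x - y) & integer_points `<=` L].

Definition coset L t : set 'rV[R]_d := [set x | L (x - t)].

(** The side length is a natural number, so that a box is tiled by translates
    of the unit cube. *)
Definition box lo s : set 'rV[R]_d :=
  [set x | forall i, lo 0 i <= x 0 i < lo 0 i + s%:R].

Definition fracv x : 'rV[R]_d := \row_i (x 0 i - (Num.floor (x 0 i))%:~R).

Lemma fracv_cube x : unit_cube (fracv x).
Proof.
move=> i; rewrite mxE; have /andP[h1 h2] := floor_itv (x 0 i).
by rewrite subr_ge0 h1 ltrBlDr addrC -[X in _ + X]/(1%:~R) -intrD.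
Qed.

Lemma sub_fracv x : integer_points (x - fracv x).
Proof. by move=> i; rewrite !mxE opprB addrCA subrr addr0 intr_int. Qed.

Variable L : set 'rV[R]_d.
Hypothesis perL : periodic_group L.

Lemma periodic_groupN x : L x -> L (- x).
Proof. by case: perL => L0 LB _ Lx; rewrite -sub0r; exact: LB. Qed.

Lemma periodic_groupD x y : L x -> L y -> L (x + y).
Proof.
case: perL => _ LB _ Lx Ly; rewrite -[y]opprK; apply: LB => //.
exact: periodic_groupN.
Qed.

Lemma periodic_groupM (z : int) x : L x -> L (z%:~R *: x).
Proof.
move=> Lx; have LMn n : L (n%:R *: x).
  elim: n => [|n IH]; first by rewrite scale0r; case: perL.
  by rewrite mulrS scalerDl scale1r; exact: periodic_groupD.
case: z => n; first exact: LMn.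
by rewrite NegzE mulrNz scaleNr; apply: periodic_groupN; exact: LMn.
Qed.

Lemma fracv_coset t x : coset L t x -> lattice_point_set L (fracv (x - t)).
Proof.
move=> Lxt; split; last exact: fracv_cube.
case: perL => _ LB LZ; rewrite -[fracv _](subKr (x - t)); apply: LB => //.
exact/LZ/sub_fracv.
Qed.

Hypothesis finP : finite_set (lattice_point_set L).

(** Modulo [Z^d] a coset of [L] has as many points as [L] has in the unit cube,
    and a box of side [s] contains at most [s ^ d] representatives of each class
    modulo [Z^d].  So a point is determined by its class relative to [t] and by
    the unit cell of the box in which it lies. *)
Lemma cnt_coset_box A t lo s : A `<=` box lo s.+1 ->
  finite_set (A `&` coset L t) /\
  (cnt (A `&` coset L t) <= cnt (lattice_point_set L) * s.+1 ^ d)%N.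
Proof.
move=> Abox.
pose cell x : {ffun 'I_d -> 'I_s.+1} :=
  [ffun i => inord (absz (Num.floor (x 0 i - lo 0 i)))].
pose code x := (fracv (x - t), cell x).
have cellE x i : A x -> Num.floor (x 0 i - lo 0 i) = (cell x i)%:Z.
  move=> /Abox/(_ i)/andP[lox xlo]; rewrite ffunE.
  have fl0 : 0 <= Num.floor (x 0 i - lo 0 i) by rewrite floor_ge0 subr_ge0.
  rewrite inordK ?gez0_abs// -ltz_nat gez0_abs//.
  by rewrite floor_lt_int ltrBlDl.
have codeP x : (A `&` coset L t) x ->
    (lattice_point_set L `*` [set: {ffun 'I_d -> 'I_s.+1}]) (code x).
  by move=> [_ xt]; split => //=; exact: fracv_coset.
have code_inj x y : (A `&` coset L t) x -> (A `&` coset L t) y ->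
    code x = code y -> x = y.
  move=> [Ax _] [Ay _] [fxy cxy].
  apply/rowP => i.
  have := congr1 (fun v : 'rV_d => v 0 i) fxy; rewrite !mxE.
  have := cellE x i Ax; rewrite cxy -cellE//.
  set u := x 0 i; set v := y 0 i => fl fr.
  have fu := floor_itv (u - lo 0 i); have fv := floor_itv (v - lo 0 i).
  rewrite fl in fu.
  have uvE : u - v = (Num.floor (u - t 0 i) - Num.floor (v - t 0 i))%:~R.
    by rewrite intrB; lra.
  move: fu fv; rewrite !intrD => fu fv.
  have : `|u - v| < 1 by rewrite ltr_norml; lra.
  rewrite uvE -intr_norm -[X in _ < X]/(1%:~R) ltr_int => h.
  have h0 : Num.floor (u - t 0 i) - Num.floor (v - t 0 i) = 0 by lia.
  by apply/eqP; rewrite -subr_eq0 uvE h0.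
have finX : finite_set (lattice_point_set L `*` [set: {ffun 'I_d -> 'I_s.+1}]).
  by apply: finite_setX => //; exact: finite_finset.
split; first exact: finite_set_inj finX codeP code_inj.
have := leq_cnt finX codeP code_inj.
by rewrite cntX// card_ffun !card_ord.
Qed.
End periodic.

(** * The Euclidean scalar product *)

Section norms.
Context {R : realType} {d : nat}.
Implicit Types x y h : 'rV[R]_d.

Lemma dotvC x y : dotv x y = dotv y x.
Proof. by apply: eq_bigr => i _; rewrite mulrC. Qed.

Lemma dotvDl x y h : dotv (x + y) h = dotv x h + dotv y h.
Proof. by rewrite /dotv -big_split/=; apply: eq_bigr => i _; rewrite mxE mulrDl. Qed.

Lemma dotvZl a x y : dotv (a *: x) y = a * dotv x y.
Proof. by rewrite /dotv mulr_sumr; apply: eq_bigr => i _; rewrite mxE mulrA. Qed.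

Lemma dotvDr h x y : dotv h (x + y) = dotv h x + dotv h y.
Proof. by rewrite dotvC dotvDl !(dotvC h). Qed.

Lemma dotvZr a x y : dotv x (a *: y) = a * dotv x y.
Proof. by rewrite dotvC dotvZl dotvC. Qed.

Lemma dotvBl x y h : dotv (x - y) h = dotv x h - dotv y h.
Proof. by rewrite dotvDl -scaleN1r dotvZl mulN1r. Qed.

Lemma dotv_ge0 x : 0 <= dotv x x.
Proof. by apply: sumr_ge0 => i _; rewrite -expr2 sqr_ge0. Qed.

Lemma sqr_coord_le x i : x 0 i ^+ 2 <= dotv x x.
Proof.
rewrite /dotv (bigD1 i)//= -expr2 lerDl.
by apply: sumr_ge0 => j _; rewrite -expr2 sqr_ge0.
Qed.

Lemma dotv_eq0 x : (dotv x x == 0) = (x == 0).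
Proof.
apply/eqP/eqP => [x0|->]; last by rewrite /dotv big1// => i _; rewrite mxE mul0r.
apply/rowP => i; rewrite mxE; apply/eqP; rewrite -sqrf_eq0 eq_le sqr_ge0 andbT.
by rewrite -x0 sqr_coord_le.
Qed.

Lemma dotv_gt0 x : (0 < dotv x x) = (x != 0).
Proof. by rewrite lt_neqAle dotv_ge0 andbT eq_sym dotv_eq0. Qed.

Lemma norm2_ge0 x : 0 <= norm2 x. Proof. exact: sqrtr_ge0. Qed.

Lemma norm2_gt0 x : (0 < norm2 x) = (x != 0).
Proof. by rewrite sqrtr_gt0 dotv_gt0. Qed.

Lemma sqr_norm2 x : norm2 x ^+ 2 = dotv x x.
Proof. by rewrite sqr_sqrtr// dotv_ge0. Qed.

Lemma coord_le_norm2 x i : `|x 0 i| <= norm2 x.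
Proof. by rewrite -sqrtr_sqr ler_wsqrtr// sqr_coord_le. Qed.

Lemma nonzero_coord x : x != 0 -> exists i, x 0 i != 0.
Proof.
move/eqP => x0; apply: contrapT => xi; apply: x0; apply/rowP => i.
by rewrite mxE; apply: contrapT => /eqP xi0; apply: xi; exists i.
Qed.

Lemma dotv_delta x i : dotv x (delta_mx 0 i) = x 0 i.
Proof.
rewrite /dotv (bigD1 i)//= big1 => [|j ji]; first by rewrite addr0 mxE !eqxx mulr1.
by rewrite mxE (negPf ji) andbF mulr0.
Qed.

Lemma integer_delta i : integer_points (delta_mx 0 i : 'rV[R]_d).
Proof. by move=> j; rewrite mxE; case: (_ && _); rewrite ?rpred0 ?rpred1. Qed.
End norms.

(** * Counting along lattice lines *)

Section ends.
Context {R : realType} {d : nat}.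
Implicit Types (A K L : set 'rV[R]_d) (x y b t lo : 'rV[R]_d) (s : nat).
Variable L : set 'rV[R]_d.
Hypothesis perL : periodic_group L.
Hypothesis finP : finite_set (lattice_point_set L).

(** A point [x] of the coset in [A] with [x + b] outside of [A] is the last one
    of its line in direction [b], because [A] is convex.  Hence the translates
    [x + k b], [k <= m], of all these points are pairwise distinct.  If
    [m * norm2 b <= 1] they lie in a box whose side is larger by one only, so
    the number of ends is at most [1 / (m + 1)] of the number of points in that
    box. *)
Lemma cnt_ends A t lo s b : cvx A -> A `<=` box lo s.+1 -> L b ->
  (cnt [set x | (A `&` coset L t) x /\ ~ A (x + b)])%:R
    <= (cnt (lattice_point_set L) * s.+2 ^ d)%:R * norm2 b.
Proof.
move=> cA Abox Lb; set E := [set x | _].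
have [b0|b0] := eqVneq b 0.
  have -> : E = set0.
    by apply/seteqP; split=> // x [[Ax _]]; rewrite b0 addr0 => /(_ Ax).
  by rewrite /cnt fset_set0 cardfs0 mulr_ge0// norm2_ge0.
have bgt0 : 0 < norm2 b by rewrite norm2_gt0.
pose m := absz (Num.floor (norm2 b)^-1).
have [mle ltm] : m%:R <= (norm2 b)^-1 /\ (norm2 b)^-1 < m.+1%:R.
  have /andP[] := floor_itv (norm2 b)^-1.
  have fl0 : 0 <= Num.floor (norm2 b)^-1 by rewrite floor_ge0 invr_ge0 ltW.
  rewrite -[Num.floor _]gez0_abs// -/m => h1 h2; split => //.
  by rewrite -natr1; move: h2; rewrite intrD.
(* k b has coordinates of absolute value at most 1, with the signs of those of b *)
pose lo' := \row_i (if 0 <= b 0 i then lo 0 i else lo 0 i - 1) : 'rV[R]_d.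
pose f (p : 'rV[R]_d * 'I_m.+1) := p.1 + p.2%:R *: b.
pose B := f @` (E `*` [set: 'I_m.+1]).
have Bbox : B `<=` box lo' s.+2.
  move=> _ [[x k] [[[Ax _] _] _] <-] i; rewrite /f/= !mxE.
  have /andP[h1 h2] := Abox x Ax i.
  have hk : k%:R * `|b 0 i| <= 1.
    apply: (@le_trans _ _ (m%:R * norm2 b)); last by rewrite -ler_pdivlMr// div1r.
    by apply: ler_pM => //; [rewrite ler_nat -ltnS|exact: coord_le_norm2].
  rewrite -[s.+2%:R]natr1.
  have k0 : 0 <= k%:R :> R by [].
  case: ifPn => bi.
    by rewrite ger0_norm// in hk; have := mulr_ge0 k0 bi; lra.
  rewrite -ltNge in bi; rewrite ltr0_norm// in hk.
  have := mulr_ge0_le0 k0 (ltW bi); lra.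
have [finB cntB] := cnt_coset_box perL finP t Bbox.
have fB p : (E `*` [set: 'I_m.+1]) p -> (B `&` coset L t) (f p).
  move=> Ep; split; first by exists p.
  case: p Ep => x k [[[_ xt] _] _]; rewrite /coset/= /f/= addrAC.
  exact/(periodic_groupD perL)/(periodic_groupM perL k).
(* y is the last point of its line, so x = y + (l - k) b cannot lie beyond it *)
have key x y (k l : nat) : E x -> E y -> (k < l)%N ->
    x + k%:R *: b = y + l%:R *: b -> False.
  move=> [[Ax _] _] [[Ay _] nAy] kl xy; apply: nAy.
  have xE : x = y + (l - k)%:R *: b.
    by rewrite natrB 1?ltnW// scalerBl addrA -xy addrK.
  pose u : R := (l - k)%:R^-1.
  have lk1 : 1 <= (l - k)%:R :> R by rewrite ler1n subn_gt0.
  have -> : y + b = u *: x + (1 - u) *: y.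
    rewrite xE scalerDr scalerA mulVf; last by rewrite gt_eqF// (lt_le_trans ltr01).
    by rewrite scale1r addrAC -scalerDl [u + _]addrC subrK scale1r.
  by apply: cA => //; rewrite invr_ge0 ler0n/= invf_le1// (lt_le_trans ltr01).
have finj p q : (E `*` [set: 'I_m.+1]) p -> (E `*` [set: 'I_m.+1]) q ->
    f p = f q -> p = q.
  case: p q => [x k] [y l] [Ex _] [Ey _]; rewrite /f /= => xy.
  have [kl|lk|/val_inj kl] := ltngtP k l.
  - by case: (key x y k l).
  - by case: (key y x l k).
  - by rewrite kl in xy *; move/addIr: xy => ->.
have finE : finite_set E.
  have [finA _] := cnt_coset_box perL finP t Abox.
  by apply: sub_finite_set finA => x [].
have := leq_cnt finB fB finj; rewrite cntX// card_ord => /leq_trans/(_ cntB) h.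
rewrite -ler_pdivrMr//; apply: le_trans (_ : (cnt E * m.+1)%:R <= _).
  by rewrite natrM ler_wpM2l// ltW.
by rewrite ler_nat.
Qed.

(** Every point of the coset in [A] that is not the end of its line is sent
    injectively into [B]; the ends are few by [cnt_ends].  The translation vector
    [w] varies with the use: it is a fraction of [b] for a shifted lattice, [b]
    for a dilated set and [0] for an eroded one. *)
Lemma cnt_step A B t lo s b w : cvx A -> A `<=` box lo s.+1 -> L b ->
  finite_set B -> (forall x, A x -> A (x + b) -> coset L t x -> B (x + w)) ->
  (cnt (A `&` coset L t))%:R
    <= (cnt B)%:R + (cnt (lattice_point_set L) * s.+2 ^ d)%:R * norm2 b.
Proof.
move=> cA Abox Lb finB AB; have [finA _] := cnt_coset_box perL finP t Abox.
apply: le_trans (lerD (lexx _) (cnt_ends t cA Abox Lb)).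
set E := [set x | _]; rewrite -natrD ler_nat.
have finE : finite_set E by apply: sub_finite_set finA => x [].
pose F := [set x | (A `&` coset L t) x /\ A (x + b)].
have finF : finite_set F by apply: sub_finite_set finA => x [].
apply: (@leq_trans (cnt (F `|` E))).
  apply: cnt_le; first by rewrite finite_setU.
  by move=> x Ax; have [|] := pselect (A (x + b)); [left|right].
apply: (leq_trans (cntU finF finE)); rewrite leq_add2r.
apply: (@leq_cnt _ _ _ _ (fun x => x + w)) => // [x [[Ax xt] Axb]|x y _ _ /addIr//].
exact: AB.
Qed.

(** Sliding the points of the lattice along one lattice direction changes their
    number in a convex set by at most one on each line. *)
Lemma cnt_shift K t lo b (u : R) : cvx K -> K `<=` box lo 1 -> L b ->
  (cnt (K `&` coset L (t + u *: b)))%:R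
    <= (cnt (K `&` coset L t))%:R
       + (cnt (lattice_point_set L) * 2 ^ d)%:R * norm2 b.
Proof.
move=> cK Kbox Lb; have [finK _] := cnt_coset_box perL finP t Kbox.
pose v := u - (Num.floor u)%:~R.
have v01 : 0 <= v <= 1.
  have := floor_itv u; rewrite intrD => /andP[h1 h2].
  by rewrite /v; apply/andP; split; lra.
apply: (@cnt_step _ _ _ lo 0 b ((1 - v) *: b)) => // x Kx Kxb xt; split.
  have -> : x + (1 - v) *: b = v *: x + (1 - v) *: (x + b).
    by rewrite scalerDr addrA -scalerDl addrC [v + _]addrC subrK scale1r addrC.
  exact: cK.
(* modulo L, the shift by u b is the shift by v b, and x + (1 - v) b undoes it *)
rewrite /coset/=; have -> : x + (1 - v) *: b - t =
    x - (t + u *: b) + (1 + Num.floor u)%:~R *: b.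
  by apply/rowP => i; rewrite !mxE /v intrD; ring.
exact/(periodic_groupD perL)/(periodic_groupM perL).
Qed.

End ends.

(** * Volumes of convex sets from grid points *)

Section vol.
Context {R : realType} {d : nat}.
Implicit Types (A B : set 'rV[R]_d).

Let tup A : set (d.-tuple (measurableTypeR R)) :=
  [set t | A (\row_i tnth t i)].

Lemma le_vol A B : A `<=` B -> (vol A <= vol B)%E.
Proof. by move=> AB; apply: le_mu_ext => t /AB. Qed.

Lemma vol_ge0 A : (0 <= vol A)%E.
Proof. exact: outer_measure_ge0. Qed.

Lemma vol_bigU (I : Type) (s : seq I) (F : I -> set 'rV[R]_d) :
  (vol (\big[setU/set0]_(i <- s) F i) <= \sum_(i <- s) vol (F i))%E.
Proof.
elim: s => [|i s IH].
  rewrite !big_nil /vol (_ : [set t | _] = set0) ?outer_measure0//.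
rewrite !big_cons; apply: le_trans (leeD (lexx _) IH).
exact: (outer_measureU2 _ (tup (F i)) (tup _)).
Qed.

Definition cell (M : nat) (k : {ffun 'I_d -> 'I_M}) : set 'rV[R]_d :=
  [set x | forall i, (k i)%:R / M%:R <= x 0 i < (k i)%:R / M%:R + M%:R^-1].

Lemma vol_cell M (k : {ffun 'I_d -> 'I_M}) : vol (cell k) = (M%:R ^- d)%:E.
Proof.
rewrite vol_box; last by move=> i; rewrite lerDl invr_ge0.
congr EFin; under eq_bigr do rewrite addrAC subrr add0r.
by rewrite prodr_const card_ord exprVn.
Qed.

Lemma vol_cells_ge A M (P : pred {ffun 'I_d -> 'I_M}) :
  (0 < M)%N -> (forall k, P k -> cell k `<=` A) ->
  ((#|P|%:R / M%:R ^+ d)%:E <= vol A)%E.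
Proof.
move=> M0 PA.
have mcell k : measurable (tup (@cell M k)).
  rewrite (_ : tup _ =
      \bigcap_(i in [set: 'I_d])
        ((fun t : d.-tuple (measurableTypeR R) => tnth t i)
           @^-1` `[(k i)%:R / M%:R, (k i)%:R / M%:R + M%:R^-1[%classic)).
    apply: fin_bigcap_measurable => // i _.
    by rewrite -[X in measurable X]setTI; exact: measurable_tnth.
  apply/seteqP; split=> t /= At i => [_|].
    by move: (At i); rewrite /= mxE in_itv.
  by move: (At i I); rewrite /= mxE in_itv.
have trivc : trivIset [set` enum P] (fun k => tup (@cell M k)).
  move=> k l _ _ [t [tk tl]]; apply/ffunP => i; apply: val_inj; apply/eqP.
  have := tk i; have := tl i; rewrite mxE.
  have M0' : 0 < M%:R :> R by rewrite ltr0n.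
  have M1 : M%:R != 0 :> R by rewrite gt_eqF.
  rewrite -[X in _ + X]mul1r -mulrDl.
  rewrite -(ler_pM2r M0') -(ltr_pM2r M0') !divfK//.
  move=> /andP[h1 h2]; rewrite -[X in _ + X]mul1r -mulrDl.
  rewrite -(ler_pM2r M0') -(ltr_pM2r M0') !divfK//.
  move=> /andP[h3 h4].
  have := le_lt_trans h1 h4; have := le_lt_trans h3 h2.
  rewrite !natr1 !ltr_nat !ltnS => kl lk.
  by rewrite /= eqn_leq kl lk.
have cellsA : \bigcup_(k in [set` enum P]) @cell M k `<=` A.
  by move=> x [k /=]; rewrite mem_enum => Pk; exact: PA.
apply: le_trans (le_vol cellsA).
rewrite /vol -/(tup _) (_ : tup _ = \bigcup_(k in [set` enum P]) tup (@cell M k)); last first.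
  by apply/seteqP; split=> t [k Pk kt]; exists k.
have finP : finite_set [set` enum P] by exact: finite_finset.
rewrite measurable_mu_extE; last exact: fin_bigcup_measurable.
rewrite measure_fin_bigcup//.
rewrite (eq_fsbigr (fun=> (M%:R ^- d)%:E)); last first.
  move=> k _; rewrite -(vol_cell k) /vol measurable_mu_extE //; exact: mcell.
rewrite -fsbig_seq ?enum_uniq// sumEFin big_enum/= sumr_const.
by rewrite -[(_ ^- d) *+ _]mulr_natl.
Qed.

Lemma vol_cells_le A M (P : pred {ffun 'I_d -> 'I_M}) :
  (forall x, A x -> exists2 k, P k & cell k x) ->
  (vol A <= (#|P|%:R / M%:R ^+ d)%:E)%E.
Proof.
move=> PA; have Acells : A `<=` \big[setU/set0]_(k <- enum P) @cell M k.
  by move=> x /PA[k Pk kx]; rewrite -bigcup_seq; exists k; rewrite //= mem_enum.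
apply: (le_trans (le_vol Acells)); apply: (le_trans (vol_bigU _ _)).
under eq_bigr do rewrite vol_cell.
by rewrite sumEFin big_enum/= sumr_const -[(_ ^- d) *+ _]mulr_natl.
Qed.
End vol.

Section grid.
Context {R : realType} {d : nat}.
Implicit Types (A K L : set 'rV[R]_d) (x y s : 'rV[R]_d) (M : nat).

Definition grid M : set 'rV[R]_d :=
  [set x | forall i, M%:R * x 0 i \is a Num.int].

Definition grid_point M (k : {ffun 'I_d -> 'I_M}) : 'rV[R]_d :=
  \row_i ((k i)%:R / M%:R).

Lemma periodic_grid M : periodic_group (grid M).
Proof.
split=> [i|x y xM yM i|x xZ i]; first by rewrite mxE mulr0 rpred0.
  by rewrite !mxE mulrBr rpredB.
by rewrite rpredM// rpred_nat.
Qed.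

Lemma gridP M x : (0 < M)%N -> unit_cube x -> grid M x ->
  exists k, x = @grid_point M k.
Proof.
move=> M0 x01 xM; have M0' : 0 < M%:R :> R by rewrite ltr0n.
have kP i : exists k : 'I_M, M%:R * x 0 i = k%:R.
  have /andP[x0 x1] := x01 i.
  have /intrP[z zE] := xM i.
  have z0 : 0 <= z by rewrite -(ler_int R) -zE mulr_ge0// ltW.
  have zM : (`|z| < M)%N.
    rewrite -ltz_nat gez0_abs// -(ltr_int R) -zE.
    by rewrite -[ltRHS]mulr1 ltr_pM2l.
  by exists (Ordinal zM); rewrite zE/= -[in LHS](gez0_abs z0).
have [k kE] := choice kP.
exists (finfun k); apply/rowP => i.
by rewrite mxE ffunE -kE mulrC mulKf// gt_eqF.
Qed.

Lemma grid_point_inj M : (0 < M)%N -> injective (@grid_point M).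
Proof.
move=> M0 k l kl; apply/ffunP => i; apply/val_inj/eqP.
have := congr1 (fun v : 'rV_d => v 0 i) kl; rewrite !mxE.
have M0' : M%:R != 0 :> R by rewrite pnatr_eq0 -lt0n.
by move/(mulIf (invr_neq0 M0'))/eqP; rewrite eqr_nat.
Qed.

Lemma grid_grid_point M k : grid M (@grid_point M k).
Proof.
move=> i; rewrite mxE mulrC; have [->|M0] := eqVneq (M%:R : R) 0.
  by rewrite mulr0 rpred0.
by rewrite divfK// rpred_nat.
Qed.

Lemma unit_cube_grid_point M k : unit_cube (@grid_point M k).
Proof.
move=> i; have M0 : 0 < M%:R :> R by rewrite ltr0n (leq_trans _ (ltn_ord (k i))).
by rewrite mxE divr_ge0//= ltr_pdivrMr// mul1r ltr_nat.
Qed.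

Lemma gridE M K : (0 < M)%N -> K `<=` unit_cube ->
  K `&` grid M = (@grid_point M) @` [set k | K (@grid_point M k)].
Proof.
move=> M0 K01; apply/seteqP; split=> [x [Kx xM]|_ [k Kk <-]].
  by have [k xE] := gridP M0 (K01 x Kx) xM; exists k => //; rewrite /= -xE.
by split => //; exact: grid_grid_point.
Qed.

Lemma finite_grid M K : (0 < M)%N -> K `<=` unit_cube -> finite_set (K `&` grid M).
Proof. by move=> M0 K01; rewrite gridE//; apply: finite_image; exact: finite_finset. Qed.

Lemma cnt_grid M K : (0 < M)%N -> K `<=` unit_cube ->
  cnt (K `&` grid M) = #|[pred k | `[< K (@grid_point M k) >]]|.
Proof.
move=> M0 K01; rewrite gridE// /cnt fset_set_image; last exact: finite_finset.
rewrite card_imfset/=; last exact: grid_point_inj.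
have -> : [set k | K (@grid_point M k)] = [set` [pred k | `[< K (@grid_point M k) >]]].
  by apply/seteqP; split=> k /asboolP.
rewrite -card_finset; congr #|` _|; apply/fsetP => k.
rewrite in_fset_set; last exact: finite_finset.
by rewrite mem_setE; apply/idP/imfsetP => [kP|[l lP ->]//]; exists k.
Qed.

Lemma cnt_grid_cube M : (0 < M)%N -> cnt (lattice_point_set (grid M)) = (M ^ d)%N.
Proof.
move=> M0; rewrite /lattice_point_set setIC cnt_grid//.
rewrite -[M in RHS]card_ord -[d in RHS]card_ord -card_ffun; apply: eq_card => k.
by rewrite !inE; apply/asboolP/unit_cube_grid_point.
Qed.

Lemma finite_grid_cube M : (0 < M)%N -> finite_set (lattice_point_set (grid M)).
Proof. by move=> M0; rewrite /lattice_point_set setIC; exact: finite_grid. Qed.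

Lemma coset0 L : coset L 0 = L.
Proof. by apply/seteqP; split=> x; rewrite /coset/= subr0. Qed.

Section step.
Variables (M : nat).
Hypothesis M0 : (0 < M)%N.

(** [dilate r K] and [erode r K] are the Minkowski sum and the erosion of [K]
    by the face of the cube [[-1/M, 0]^d], resp. [[0, 1/M]^d], that is spanned by
    the coordinates in [r].  Enlarging [r] by one coordinate changes the number of
    grid points by at most one on each line in this direction.  When [r] contains
    all coordinates, the grid cells meeting [K] have their lower corner in
    [dilate r K], and those with their lower corner in [erode r K] are contained
    in [K]. *)
Definition small (r : seq 'I_d) s :=
  forall i, 0 <= s 0 i <= M%:R^-1 /\ (i \notin r -> s 0 i = 0).
Definition dilate r K : set 'rV[R]_d := [set x | exists2 s, small r s & K (x + s)].
Definition erode r K : set 'rV[R]_d := [set x | forall s, small r s -> K (x + s)].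

Let MV0 : 0 < M%:R^-1 :> R. Proof. by rewrite invr_gt0 ltr0n. Qed.

Lemma small0 r : small r 0.
Proof. by move=> i; rewrite mxE lexx ltW. Qed.

Lemma small_nil s : small [::] s -> s = 0.
Proof. by move=> s0; apply/rowP => i; have [_ ->] := s0 i; rewrite ?mxE. Qed.

Lemma small_conv r s s' l : small r s -> small r s' -> 0 <= l <= 1 ->
  small r (l *: s + (1 - l) *: s').
Proof.
move=> rs rs' l01 i; have [si ri] := rs i; have [s'i r'i] := rs' i.
rewrite !mxE; split; first exact: conv_itv.
by move=> ir; rewrite ri// r'i// !mulr0 addr0.
Qed.

Lemma cvx_dilate r K : cvx K -> cvx (dilate r K).
Proof.
move=> cK x y l [s rs Ks] [s' rs' Ks'] l01.
exists (l *: s + (1 - l) *: s'); first exact: small_conv.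
by rewrite addrACA -!scalerDr; exact: cK.
Qed.

Lemma cvx_erode r K : cvx K -> cvx (erode r K).
Proof.
move=> cK x y l Ex Ey l01 s rs.
have -> : l *: x + (1 - l) *: y + s = l *: (x + s) + (1 - l) *: (y + s).
  by apply/rowP => i; rewrite !mxE; ring.
by apply: cK => //; [exact: Ex|exact: Ey].
Qed.

Definition unitM i : 'rV[R]_d := M%:R^-1 *: delta_mx 0 i.

Lemma unitM_self i : unitM i 0 i = M%:R^-1.
Proof. by rewrite !mxE !eqxx mulr1. Qed.

Lemma unitM_other i j : j != i -> unitM i 0 j = 0.
Proof. by move=> ji; rewrite !mxE (negPf ji) andbF mulr0. Qed.

Lemma grid_unitM i : grid M (unitM i).
Proof.
move=> j; have [->|ji] := eqVneq j i; last by rewrite unitM_other// mulr0 rpred0.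
by rewrite unitM_self divff ?rpred1// pnatr_eq0 -lt0n.
Qed.

Lemma norm2_unitM i : norm2 (unitM i) = M%:R^-1.
Proof.
rewrite /norm2 /dotv (bigD1 i)//= big1 => [|j ji].
  by rewrite addr0 unitM_self -expr2 sqrtr_sqr ger0_norm// ltW.
by rewrite unitM_other// mulr0.
Qed.

Lemma dilate_step i r K x : cvx K ->
  dilate (i :: r) K x -> dilate (i :: r) K (x + unitM i) ->
  dilate r K (x + unitM i).
Proof.
move=> cK [s rs Ks] [s' rs' Ks'].
have [/andP[s0 s1] _] := rs i; have [/andP[s'0 s'1] _] := rs' i.
(* the weight for which the point of the segment from x + s to x + e_i + s'
   has the same i-th coordinate as x + e_i; if the denominator vanishes then
   s' 0 i = 0 and the weight 0 is right *)
pose l := s' 0 i / (M%:R^-1 + s' 0 i - s 0 i).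
have D0 : 0 <= M%:R^-1 + s' 0 i - s 0 i by lra.
have l01 : 0 <= l <= 1.
  rewrite divr_ge0//=; have [D00|D1] := eqVneq (M%:R^-1 + s' 0 i - s 0 i) 0.
    by rewrite /l D00 invr0 mulr0.
  by rewrite ler_pdivrMr ?mul1r ?lt_neqAle 1?eq_sym ?D1//; lra.
have lE : l * s 0 i + (1 - l) * s' 0 i = l * M%:R^-1.
  have [D00|D1] := eqVneq (M%:R^-1 + s' 0 i - s 0 i) 0.
    by rewrite /l D00 invr0 mulr0 !mul0r subr0 mul1r add0r; lra.
  have : l * (M%:R^-1 + s' 0 i - s 0 i) = s' 0 i by rewrite /l divfK.
  by nra.
exists (l *: s + (1 - l) *: s' - l *: unitM i).
  move=> j; have -> : (l *: s + (1 - l) *: s' - l *: unitM i) 0 j =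
      l * s 0 j + (1 - l) * s' 0 j - l * unitM i 0 j by rewrite !mxE.
  have [->|ji] := eqVneq j i.
    by rewrite unitM_self lE subrr lexx ltW.
  have [sj rj] := rs j; have [s'j r'j] := rs' j.
  rewrite unitM_other// mulr0 subr0; split; first exact: conv_itv.
  move=> jr; have jir : j \notin i :: r by rewrite in_cons negb_or ji.
  by rewrite rj// r'j// !mulr0 addr0.
have -> : x + unitM i + (l *: s + (1 - l) *: s' - l *: unitM i) =
    l *: (x + s) + (1 - l) *: (x + unitM i + s').
  by apply/rowP => j; rewrite !mxE; ring.
exact: cK.
Qed.

Lemma erode_step i r K x : cvx K ->
  erode r K x -> erode r K (x + unitM i) -> erode (i :: r) K x.
Proof.
move=> cK Ex Exi s rs; have M1 : M%:R != 0 :> R by rewrite pnatr_eq0 -lt0n.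
pose l := M%:R * s 0 i; have [/andP[si0 si1] _] := rs i.
have l01 : 0 <= l <= 1.
  rewrite /l mulr_ge0//= (le_trans (ler_wpM2l _ si1))//.
  by rewrite divff.
have lE : l * M%:R^-1 = s 0 i by rewrite /l mulrAC divff// mul1r.
pose s0 := s - l *: unitM i.
have s0r : small r s0.
  move=> j; have -> : s0 0 j = s 0 j - l * unitM i 0 j by rewrite !mxE.
  have [->|ji] := eqVneq j i; first by rewrite unitM_self lE subrr lexx ltW.
  have [sj rj] := rs j; rewrite unitM_other// mulr0 subr0; split => // jr.
  by apply: rj; rewrite in_cons negb_or ji.
have -> : x + s = l *: (x + unitM i + s0) + (1 - l) *: (x + s0).
  by apply/rowP => j; rewrite !mxE; ring.
by apply: cK => //; [exact: Exi|exact: Ex].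
Qed.

Lemma dilate_box r K : K `<=` unit_cube -> dilate r K `<=` box (- const_mx 1) 2.
Proof.
move=> K01 x [s rs Ks] i; have /andP[] := K01 _ Ks i; rewrite !mxE.
have [/andP[s0 s1] _] := rs i.
have : M%:R^-1 <= 1 :> R by rewrite invf_le1 ?ler1n ?ltr0n.
by move=> h1 h2 h3; apply/andP; split; lra.
Qed.

Lemma erode_sub r K : erode r K `<=` K.
Proof. by move=> x Ex; rewrite -[x]addr0; apply: Ex; exact: small0. Qed.

Let err : R := 3 ^+ d * (M ^ d)%:R / M%:R.

Let finM : finite_set (lattice_point_set (grid M)).
Proof. exact: finite_grid_cube. Qed.

Lemma errE : (cnt (lattice_point_set (grid M)) * 3 ^ d)%:R / M%:R = err.
Proof. by rewrite /err cnt_grid_cube// natrM [(3 ^ d)%:R]natrX [_%:R * _]mulrC. Qed.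

Lemma cnt_dilate r K : cvx K -> K `<=` unit_cube ->
  (cnt (dilate r K `&` grid M))%:R
    <= (cnt (K `&` grid M))%:R + (size r)%:R * err.
Proof.
move=> cK K01; elim: r => [|i r IH].
  rewrite mul0r addr0 ler_nat; apply: cnt_le; first exact: finite_grid.
  by move=> x [[s /small_nil -> ]]; rewrite addr0.
rewrite -natr1 mulrDl mul1r addrA; apply: le_trans (lerD IH (lexx _)).
rewrite -errE -(norm2_unitM i) -[X in (cnt (_ `&` X))%:R <= _]coset0.
apply: (@cnt_step _ _ _ (periodic_grid M) finM _ _ 0 (- const_mx 1) 1 _ (unitM i)).
- exact: cvx_dilate.
- exact: dilate_box.
- exact: grid_unitM.
- rewrite -[X in _ `&` X]coset0.
  by have [] := cnt_coset_box (periodic_grid M) finM 0 (@dilate_box r _ K01).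
- move=> x Dx Dxi; rewrite coset0 => xM; split; first exact: dilate_step Dx Dxi.
  exact/(periodic_groupD (periodic_grid M))/grid_unitM.
Qed.

Lemma cnt_erode r K : cvx K -> K `<=` unit_cube ->
  (cnt (K `&` grid M))%:R
    <= (cnt (erode r K `&` grid M))%:R + (size r)%:R * err.
Proof.
move=> cK K01; have finE (r' : seq 'I_d) : finite_set (erode r' K `&` grid M).
  by apply: finite_grid => // x /erode_sub/K01.
elim: r => [|i r IH].
  rewrite mul0r addr0 ler_nat; apply: cnt_le => // x [Kx xM]; split => //.
  by move=> s /small_nil ->; rewrite addr0.
apply: (le_trans IH); rewrite -natr1 mulrDl mul1r addrA addrAC lerD2r.
rewrite -errE -(norm2_unitM i) -[X in (cnt (_ `&` X))%:R <= _]coset0.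
apply: (@cnt_step _ _ _ (periodic_grid M) finM _ _ 0 (- const_mx 1) 1 (unitM i) 0) => //.
- exact: cvx_erode.
- move=> x /erode_sub Kx; apply: (dilate_box (r := [::]) K01).
  by exists 0; [exact: small0|rewrite addr0].
- exact: grid_unitM.
- move=> x Ex Exi; rewrite coset0 addr0 => xM; split => //; exact: erode_step.
Qed.

End step.

(** The outer volume of [K] lies between the total volume of the grid cells
    inside [K] and that of the cells meeting [K]; both numbers of cells differ from
    the number of grid points in [K] by a boundary term. *)
Lemma vol_grid K : cvx K -> K `<=` unit_cube ->
  exists2 v : R, vol K = v%:E & forall M, (0 < M)%N ->
    `|v - (cnt (K `&` grid M))%:R / M%:R ^+ d| <= d%:R * 3 ^+ d / M%:R.
Proof.
move=> cK K01.
have bounds M : (0 < M)%N ->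
    (((cnt (K `&` grid M))%:R / M%:R ^+ d - d%:R * 3 ^+ d / M%:R)%:E <= vol K <=
     ((cnt (K `&` grid M))%:R / M%:R ^+ d + d%:R * 3 ^+ d / M%:R)%:E)%E.
  move=> M0; have M0' : 0 < M%:R :> R by rewrite ltr0n.
  have Md0 : 0 < M%:R ^+ d :> R by rewrite exprn_gt0.
  have errM : d%:R * 3 ^+ d / M%:R =
      (size (enum 'I_d))%:R * (3 ^+ d * (M ^ d)%:R / M%:R) / M%:R ^+ d :> R.
    rewrite size_enum_ord natrX -!mulrA; congr (_ * (_ * _)).
    by rewrite mulrCA divff ?mulr1// gt_eqF.
  apply/andP; split.
    have E01 : erode M (enum 'I_d) K `<=` unit_cube by move=> x /(erode_sub M0)/K01.
    apply: (@le_trans _ _ ((cnt (erode M (enum 'I_d) K `&` grid M))%:R / M%:R ^+ d)%:E).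
      rewrite lee_fin errM -mulrBl ler_pM2r ?invr_gt0// lerBlDr.
      exact: cnt_erode.
    rewrite cnt_grid//; apply: vol_cells_ge => // k /asboolP Ek x kx.
    rewrite -[x](subrK (grid_point k)) addrC; apply: Ek => i.
    rewrite mem_enum; split=> //; have /andP[] := kx i; rewrite !mxE.
    by move=> h1 h2; apply/andP; split; lra.
  apply: (@le_trans _ _ (#|[pred k | `[< dilate M (enum 'I_d) K (@grid_point M k) >]]|%:R
     / M%:R ^+ d)%:E).
    apply: vol_cells_le => x Kx.
    have kP i : exists k : 'I_M, k%:R <= x 0 i * M%:R < k%:R + 1.
      have /andP[x0 x1] := K01 x Kx i.
      have := floor_itv (x 0 i * M%:R); rewrite intrD.
      set z := Num.floor _ => zP.
      have z0 : 0 <= z by rewrite floor_ge0 mulr_ge0// ltW.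
      have zM : (`|z| < M)%N.
        rewrite -ltz_nat gez0_abs// -(ltr_int R).
        case/andP: zP => zx _; apply: le_lt_trans zx _.
        by rewrite -[ltRHS]mul1r ltr_pM2r.
      by exists (Ordinal zM); rewrite /= -[z]gez0_abs// in zP *.
    have [k kE] := choice kP.
    have xcell i : (k i)%:R / M%:R <= x 0 i < (k i)%:R / M%:R + M%:R^-1.
      have /andP[k1 k2] := kE i; rewrite -[X in _ + X]mul1r -mulrDl.
      by rewrite ler_pdivrMr// ltr_pdivlMr// k1.
    exists (finfun k); last by move=> i; rewrite ffunE.
    apply/asboolP; exists (x - grid_point (finfun k)); last by rewrite addrC subrK.
    move=> i; rewrite mem_enum; split => //; rewrite !mxE ffunE.
    by have /andP[h1 h2] := xcell i; apply/andP; split; lra.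
  rewrite lee_fin errM -mulrDl ler_pM2r ?invr_gt0//.
  apply: le_trans (cnt_dilate M0 _ cK K01); rewrite ler_nat.
  have finD : finite_set (dilate M (enum 'I_d) K `&` grid M).
    rewrite -[X in _ `&` X]coset0.
    have Dbox := @dilate_box _ M0 (enum 'I_d) _ K01.
    by have [] := cnt_coset_box (periodic_grid M) (finite_grid_cube M0) 0 Dbox.
  apply: (@leq_trans (cnt ((dilate M (enum 'I_d) K `&` unit_cube) `&` grid M))).
    rewrite cnt_grid//; apply/subset_leq_card/fintype.subsetP => k.
    by rewrite !inE => Dk; split; last exact: unit_cube_grid_point.
  by apply: cnt_le => // x [[Dx _] xM].
have volfin : vol K \is a fin_num.
  have /andP[h1 h2] := bounds 1%N isT.
  by rewrite fin_numE; apply/andP; split; apply/eqP => v; rewrite v in h1 h2.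
exists (fine (vol K)); first by rewrite fineK.
move=> M M0; have := bounds M M0; rewrite -[vol K]fineK// !lee_fin => /andP[h1 h2].
by rewrite ler_norml; apply/andP; split; lra.
Qed.
End grid.

(** * Short lattice vectors from a dual vector *)

Section reduction.
Context {R : realType} {d : nat}.
Implicit Types (G : set 'rV[R]_d) (x y b c h : 'rV[R]_d) (cs : seq 'rV[R]_d).

(** The linear combinations of the entries; the recursion spares a family of
    coefficients indexed by entries that may be repeated. *)
Fixpoint in_span cs x : Prop :=
  if cs is c :: cs' then exists u, in_span cs' (x - u *: c) else x = 0.

Lemma in_span0 cs : in_span cs 0.
Proof. by elim: cs => //= c cs IH; exists 0; rewrite scale0r subr0. Qed.

Lemma in_spanD cs x y : in_span cs x -> in_span cs y -> in_span cs (x + y).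
Proof.
elim: cs x y => /= [x y -> ->|c cs IH x y [u xu] [v yv]]; first by rewrite addr0.
by exists (u + v); rewrite scalerDl opprD addrACA; exact: IH.
Qed.

Lemma in_spanZ cs a x : in_span cs x -> in_span cs (a *: x).
Proof.
elim: cs x => /= [x ->|c cs IH x [u xu]]; first by rewrite scaler0.
by exists (a * u); rewrite -scalerA -scalerBr; exact: IH.
Qed.

Lemma in_span_shift cs (mu : 'rV[R]_d -> R) b x : in_span cs x ->
  exists a, in_span [seq c + mu c *: b | c <- cs] (x + a *: b).
Proof.
elim: cs x => /= [x ->|c cs IH x [u /IH[a xa]]].
  by exists 0; rewrite scale0r addr0.
exists (a + u * mu c), u; congr in_span: xa.
by apply/rowP => i; rewrite !mxE; ring.
Qed.

Definition projc b x : R := dotv x b / dotv b b.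
Definition proj b x := x - projc b x *: b.

Lemma dotv_proj b x : b != 0 -> dotv (proj b x) b = 0.
Proof.
by move=> b0; rewrite /proj dotvBl dotvZl /projc divfK ?subrr// dotv_eq0.
Qed.

Lemma projB b x y : proj b (x - y) = proj b x - proj b y.
Proof.
by apply/rowP => i; rewrite !mxE /projc dotvBl; ring.
Qed.

Lemma dotv_pythagoras b x (a : R) : dotv x b = 0 ->
  dotv (x + a *: b) (x + a *: b) = dotv x x + a ^+ 2 * dotv b b.
Proof.
move=> xb; rewrite dotvDl !dotvDr !dotvZl !dotvZr (dotvC b) xb; ring.
Qed.

Definition proj_mx b : 'M[R]_d := 1%:M - (dotv b b)^-1 *: (b^T *m b).

Lemma mul_proj_mx b x : x *m proj_mx b = proj b x.
Proof.
rewrite mulmxBr mulmx1 -scalemxAr mulmxA /proj /projc.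
have -> : x *m b^T = (dotv x b)%:M.
  apply/matrixP => i j; rewrite !mxE !ord1 /dotv mulr1n.
  by apply: eq_bigr => k _; rewrite mxE.
by rewrite mul_scalar_mx scalerA mulrC.
Qed.

Definition discrete_group G :=
  [/\ G 0, forall x y, G x -> G y -> G (x - y) &
      exists2 N : nat, (0 < N)%N & forall x, G x -> integer_points (N%:R *: x)].

Lemma integer_dotv x y : integer_points x -> integer_points y ->
  dotv x y \is a Num.int.
Proof. by move=> xZ yZ; apply: rpred_sum => i _; exact: rpredM. Qed.

(** If [N] clears the denominators of [G], then [q * N] with [q] the integer
    [N^2 * dotv b b] clears those of the projections orthogonal to [b]. *)
Lemma discrete_proj G b : discrete_group G -> G b -> b != 0 ->
  discrete_group (proj b @` G).
Proof.
move=> [G0 GB [N N0 NG]] Gb b0; split.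
- by exists 0 => //; rewrite /proj /projc -(scale0r b) dotvZl mul0r mul0r scale0r subr0.
- by move=> _ _ [x Gx <-] [y Gy <-]; exists (x - y); [exact: GB|rewrite projB].
have N0' : N%:R != 0 :> R by rewrite pnatr_eq0 -lt0n.
have := integer_dotv (NG b Gb) (NG b Gb); rewrite dotvZl dotvZr.
have bb0 : 0 < dotv b b by rewrite dotv_gt0.
move=> /intrP[q qE].
have q0 : 0 < q by rewrite -(ltr_int R) -qE !mulr_gt0// ltr0n.
exists (`|q|%N * N)%N; first by rewrite muln_gt0 N0 absz_gt0 gt_eqF.
have qE' : `|q|%N%:R = N%:R * (N%:R * dotv b b) :> R.
  by rewrite qE -[in RHS](gtz0_abs q0).
move=> _ [x Gx <-].
have -> : (`|q|%N * N)%N%:R *: proj b x =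
    (`|q|%N%:R : R) *: (N%:R *: x) - dotv (N%:R *: x) (N%:R *: b) *: (N%:R *: b).
  rewrite natrM qE' dotvZl dotvZr /proj /projc.
  apply/rowP => i; rewrite !mxE; field.
  by rewrite gt_eqF.
move=> i; rewrite mxE [X in _ + X]mxE; apply: rpredB; last first.
  by rewrite mxE; apply: rpredM; [apply: integer_dotv; exact: NG|exact: NG].
by rewrite mxE; apply: rpredM; [exact: rpred_nat|exact: NG].
Qed.

(** The squared lengths are natural multiples of [N^-2]. *)
Lemma shortest_vector G x0 : discrete_group G -> G x0 -> x0 != 0 ->
  exists b, [/\ G b, b != 0 & forall x, G x -> x != 0 -> dotv b b <= dotv x x].
Proof.
move=> [G0 GB [N N0 NG]] Gx0 x00.
have N0' : 0 < N%:R :> R by rewrite ltr0n.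
have natP x : G x -> exists k : nat, N%:R ^+ 2 * dotv x x = k%:R.
  move=> Gx; have := integer_dotv (NG x Gx) (NG x Gx); rewrite dotvZl dotvZr mulrA -expr2.
  move=> /intrP[q qE]; have q0 : 0 <= q.
    by rewrite -(ler_int R) -qE mulr_ge0 ?dotv_ge0// exprn_ge0// ltW.
  by exists `|q|%N; rewrite qE -[in LHS](gez0_abs q0).
pose P k := `[< exists x, [/\ G x, x != 0 & N%:R ^+ 2 * dotv x x = k%:R] >].
have exP : exists k, P k.
  by have [k kE] := natP x0 Gx0; exists k; apply/asboolP; exists x0.
case: (ex_minnP exP) => k /asboolP[b [Gb b0 bk]] kmin.
exists b; split => // x Gx x1; have [l lE] := natP x Gx.
have /kmin : P l by apply/asboolP; exists x.
by rewrite -(ler_nat R) -bk -lE ler_pM2l// exprn_gt0.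
Qed.

Lemma round_half (u : R) : exists z : int, (u - z%:~R) ^+ 2 <= 4^-1.
Proof.
exists (Num.floor (u + 2^-1)); have := floor_itv (u + 2^-1); rewrite intrD.
move=> /andP[h1 h2]; have : `|u - (Num.floor (u + 2^-1))%:~R| <= 2^-1.
  by rewrite ler_norml; apply/andP; split; lra.
rewrite -(@ler_pXn2r _ 2) ?nnegrE// real_normK ?num_real//.
by move/le_trans; apply; rewrite exprVn -natrX.
Qed.

(** Korkine-Zolotarev reduction.  Take a shortest vector [b], project [G]
    orthogonally to [b], and apply induction to the projection.  The dual vector
    [h] obtained there is orthogonal to [b], so it is dual to [G] as well.  Each
    [c] obtained there lifts to [c + mu b] in [G] with [`|mu| <= 1/2]; as [b] is
    not longer than this lift, the squared length grows by a factor at most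
    [4/3].  That [h] lies in the span of [G] is expressed as membership in the
    double orthogonal, which is what makes it orthogonal to [b].  The rank of [W]
    is the induction parameter. *)
Lemma dual_reduction r G (W : 'M[R]_d) x0 :
  discrete_group G -> (\rank W <= r)%N -> (forall x, G x -> (x <= W)%MS) ->
  G x0 -> x0 != 0 ->
  exists cs h,
   [/\ (size cs <= r)%N,
       forall c, c \in cs -> [/\ G c, c != 0 & dotv c c * dotv h h <= (4 / 3) ^+ r],
       forall x, G x -> in_span cs x &
     [/\ h != 0, forall y, (forall x, G x -> dotv x y = 0) -> dotv h y = 0 &
         forall x, G x -> dotv h x \is a Num.int]].
Proof.
elim: r G W x0 => [|r IH] G W x0 dG rW GW Gx0 x00.
  have W0 : W = 0 by apply/eqP; rewrite -mxrank_eq0 -leqn0.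
  by have := GW x0 Gx0; rewrite W0 submx0 (negPf x00).
have [b [Gb b0 bmin]] := shortest_vector dG Gx0 x00.
have bb0 : 0 < dotv b b by rewrite dotv_gt0.
have bb1 : dotv b b != 0 by rewrite dotv_eq0.
have [_ GB _] := dG.
have GN x : G x -> G (- x).
  by move=> Gx; rewrite -sub0r; apply: GB => //; case: dG.
have GZ (z : int) x : G x -> G (x - z%:~R *: b).
  move=> Gx; apply: (GB) => //; have GM n : G (n%:R *: b).
    elim: n => [|n IHn]; first by rewrite scale0r; case: dG.
    by rewrite mulrS scalerDl scale1r -[_ *: b]opprK; apply: GB => //; exact: GN.
  case: z => n; first exact: GM.
  by rewrite NegzE mulrNz scaleNr; apply: GN; exact: GM.
have lift x : G x -> exists mu : R, mu ^+ 2 <= 4^-1 /\ G (proj b x + mu *: b).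
  move=> Gx; have [z zP] := round_half (projc b x).
  exists (projc b x - z%:~R); split => //.
  congr G: (GZ z x Gx).
  by apply/rowP => i; rewrite !mxE; ring.
have [[x1 Gx1 px1]|G1] := pselect (exists2 x, G x & proj b x != 0).
- have [] := IH (proj b @` G) (W *m proj_mx b) (proj b x1).
  + exact: discrete_proj.
  + have := mxrank_mul_ker W (proj_mx b) => rE.
    have : (0 < \rank (W :&: kermx (proj_mx b)))%N.
      rewrite lt0n mxrank_eq0; apply: contra b0 => /eqP W0.
      rewrite -submx0 -W0 sub_capmx GW// sub_kermx mul_proj_mx.
      by rewrite /proj /projc divff// scale1r subrr eqxx.
    by move=> k0; rewrite -ltnS; apply: leq_trans rW; rewrite -rE -addn1 leq_add2l.
  + by move=> _ [x Gx <-]; rewrite -mul_proj_mx; apply: submxMr; exact: GW.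
  + by exists x1.
  + by [].
  move=> cs [h [scs csP csG [h0 hG hZ]]].
  have hb : dotv h b = 0.
    by apply: hG => _ [x Gx <-]; exact: dotv_proj.
  have muP c : exists mu, c \in cs -> mu ^+ 2 <= 4^-1 /\ G (c + mu *: b).
    have [ccs|] := boolP (c \in cs); last by exists 0.
    have [[x Gx <-] _ _] := csP c ccs.
    by have [mu muP] := lift x Gx; exists mu.
  have [mu mu4] := choice muP.
  have csb c : c \in cs -> dotv c b = 0.
    by move=> /csP[[x Gx <-] _ _]; exact: dotv_proj.
  have liftP c : c \in cs ->
      let c' := c + mu c *: b in [/\ G c', c' != 0, dotv b b <= dotv c' c' &
        dotv c' c' * dotv h h <= (4 / 3) ^+ r.+1].
    move=> ccs c'; have [mu1 Gc'] := mu4 c ccs; have [_ c0 cle] := csP c ccs.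
    have c'E : dotv c' c' = dotv c c + mu c ^+ 2 * dotv b b.
      by apply: dotv_pythagoras; exact: csb.
    have c'0 : c' != 0.
      rewrite -dotv_gt0 c'E ltr_pwDl ?dotv_gt0//.
      by rewrite mulr_ge0 ?sqr_ge0// ltW.
    have bc' := bmin _ Gc' c'0; split => //.
    rewrite exprS; have hh := dotv_ge0 h.
    have cc' : dotv c' c' <= 4 / 3 * dotv c c.
      by rewrite c'E in bc' *; nra.
    apply: le_trans (ler_wpM2r hh cc') _.
    by rewrite -(mulrA (4 / 3)); apply: ler_wpM2l cle; exact: divr_ge0.
  exists (b :: [seq c + mu c *: b | c <- cs]), h; split.
  + by rewrite /= size_map.
  + move=> c; rewrite in_cons => /orP[/eqP ->|/mapP[c' c'cs ->]]; last first.
      by have [] := liftP c' c'cs.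
    split => //; case: cs csG csP liftP {scs csb mu4 muP} => [/=|c1 cs] csG csP liftP.
      by have := csG (proj b x1) (ex_intro2 _ _ x1 Gx1 erefl) => /eqP; rewrite (negPf px1).
    have [_ _ bc hc] := liftP c1 (mem_head _ _).
    by apply: le_trans hc; rewrite ler_wpM2r// dotv_ge0.
  + move=> x Gx /=.
    have [a aP] := in_span_shift mu b (csG (proj b x) (ex_intro2 _ _ x Gx erefl)).
    exists (projc b x - a); congr in_span: aP.
    by apply/rowP => i; rewrite !mxE; ring.
  + split => // [y yG|x Gx].
      apply: hG => _ [x Gx <-].
      by rewrite /proj dotvBl dotvZl !yG// mulr0 subrr.
    have -> : x = proj b x + projc b x *: b by rewrite /proj subrK.
    rewrite dotvDr dotvZr hb mulr0 addr0; apply: hZ; by exists x.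
(* here G is contained in the line of b, and it consists of the integer
   multiples of b *)
- have projG x : G x -> exists2 z : int, projc b x = z%:~R & x = z%:~R *: b.
    move=> Gx; have px : proj b x = 0.
      by apply: contrapT => /eqP px; apply: G1; exists x.
    have xE : x = projc b x *: b by apply/eqP; rewrite -subr_eq0 -/(proj b x) px.
    have [z zP] := round_half (projc b x); have Gxz := GZ z x Gx.
    suff pz : projc b x = z%:~R by exists z; rewrite // {1}xE pz.
    apply/eqP; rewrite -subr_eq0; apply: contraTT isT => u0.
    have xzE : x - z%:~R *: b = (projc b x - z%:~R) *: b by rewrite {1}xE scalerBl.
    have xz0 : x - z%:~R *: b != 0 by rewrite xzE scaler_eq0 negb_or u0.
    have := bmin _ Gxz xz0; rewrite xzE dotvZl dotvZr mulrA -expr2.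
    by move: zP bb0; set v := _ ^+ 2; nra.
  exists [:: b], ((dotv b b)^-1 *: b); split => //.
  + move=> c; rewrite inE => /eqP ->; split => //.
    rewrite dotvZl dotvZr mulVf// mulr1 divff// exprn_ege1//.
    by rewrite ler_pdivlMr// mul1r ler_nat.
  + by move=> x /projG[z _ ->]; exists z%:~R; rewrite /= subrr.
  + split.
    * by rewrite scaler_eq0 negb_or b0 andbT invr_eq0 gt_eqF.
    * by move=> y yG; rewrite dotvZl yG// mulr0.
    * move=> x /projG[z zE _]; rewrite dotvZl dotvC mulrC -[_ / _]/(projc b x) zE.
      exact: intr_int.
Qed.
End reduction.

(** * Equidistribution of the cosets *)

Lemma le_harmonic (R : realType) (x e C : R) :
  (forall j, (0 < j)%N -> x <= e + C / j%:R) -> x <= e.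
Proof.
move=> xeC; rewrite leNgt; apply/negP => ex.
have xe0 : 0 < x - e by rewrite subr_gt0.
pose j := (absz (Num.floor (`|C| / (x - e)))).+1.
have /andP[_] := floor_itv (`|C| / (x - e)).
have fl0 : 0 <= Num.floor (`|C| / (x - e)) by rewrite floor_ge0 divr_ge0// ltW.
rewrite -{1}(gez0_abs fl0) intrD -[_ + 1%:~R]/(_%:R + 1) natr1 -/j ltr_pdivrMr//.
have := xeC j isT; have j0 : 0 < j%:R :> R by rewrite ltr0n.
rewrite -lerBlDl ler_pdivlMr// mulrC => h1 h2.
by have := lt_le_trans h2 h1; rewrite ltNge ler_norm.
Qed.

Section equidistribution.
Context {R : realType} {d : nat}.
Implicit Types (A K L : set 'rV[R]_d) (x y t b h : 'rV[R]_d) (M : nat).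

Lemma unit_cube_inj x y : unit_cube x -> unit_cube y ->
  integer_points (x - y) -> x = y.
Proof.
move=> x01 y01 xy; apply/rowP => i; have := xy i; rewrite !mxE => /intrP[z zE].
have /andP[x0 x1] := x01 i; have /andP[y0 y1] := y01 i.
have : `|x 0 i - y 0 i| < 1 by rewrite ltr_norml; apply/andP; split; lra.
rewrite zE -intr_norm -[X in _ < X]/(1%:~R) ltr_int => z1.
have z0 : z = 0 by lia.
by apply/eqP; rewrite -subr_eq0 zE z0.
Qed.

Section count.
Variables (L : set 'rV[R]_d) (M : nat).
Hypotheses (perL : periodic_group L) (finP : finite_set (lattice_point_set L)).
Hypotheses (M0 : (0 < M)%N) (LM : L `<=` grid M).

Let n := cnt (lattice_point_set L).

Lemma cnt_points_gt0 : (0 < n)%N.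
Proof.
rewrite /n /cnt cardfs_gt0; apply/negP => /eqP /(fset_set_set0 finP) P0.
have : lattice_point_set L 0.
  by split; [case: perL|move=> i; rewrite mxE lexx ltr01].
by rewrite P0.
Qed.

(** The map [y |-> x - y] modulo [Z^d] is a bijection from these points onto the
    points of [L] in the unit cube. *)
Lemma card_translates x : grid M x ->
  #|[pred k | `[< L (x - @grid_point R d M k) >]]| = n.
Proof.
move=> xM; have fracP y : L (x - y) -> lattice_point_set L (fracv (x - y)).
  by move=> Lxy; exact: fracv_coset.
have inj y y' : unit_cube y -> unit_cube y' -> fracv (x - y) = fracv (x - y') -> y = y'.
  move=> y01 y'01 fE; apply: unit_cube_inj => // i.
  have := sub_fracv (x - y) i; have := sub_fracv (x - y') i; rewrite fE => h h'.
  have := rpredB h h'; congr (_ \is a Num.int); rewrite !mxE; ring.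
pose A := unit_cube `&` [set y | L (x - y)].
have AM : A `&` grid M = A.
  rewrite setIidl// => y [_ Lxy].
  rewrite -[y](subKr x); have [_ + _] := periodic_grid (R := R) (d := d) M.
  by apply => //; exact: LM.
have finA : finite_set A by rewrite -AM; apply: finite_grid => // y [].
have -> : #|[pred k | `[< L (x - @grid_point R d M k) >]]| = cnt A.
  rewrite -AM cnt_grid//; last by move=> y [].
  apply: eq_card => k; rewrite !inE; apply/asboolP/asboolP => [?|[]//].
  by split => //; exact: unit_cube_grid_point.
apply/eqP; rewrite eqn_leq; apply/andP; split.
  apply: (leq_cnt (f := fun y => fracv (x - y))) => // [y [_ Lxy]|y y' [y1 _] [y'1 _]].
    exact: fracP.
  exact: inj.
apply: (leq_cnt (f := fun p => fracv (x - p))) => // [p [Lp _]|p p' [_ p1] [_ p'1]].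
  split; first exact: fracv_cube.
  rewrite /=; have -> : x - fracv (x - p) = p + (x - p - fracv (x - p)).
    by apply/rowP => i; rewrite !mxE; ring.
  apply: (periodic_groupD perL) => //; case: perL => _ _; apply.
  exact: sub_fracv.
exact: inj.
Qed.

(** Double counting of the pairs of grid points [x] in [K] and [y] in the unit
    cube with [x - y] in [L]. *)
Lemma cnt_grid_sum K : K `<=` unit_cube ->
  (n * cnt (K `&` grid M) =
   \sum_(k : {ffun 'I_d -> 'I_M}) cnt (K `&` coset L (@grid_point R d M k)))%N.
Proof.
move=> K01.
pose a (k l : {ffun 'I_d -> 'I_M}) := `[< K (@grid_point R d M l) /\
  L (@grid_point R d M l - @grid_point R d M k) >].
have rowE k : cnt (K `&` coset L (@grid_point R d M k)) = (\sum_l a k l)%N.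
  have -> : K `&` coset L (grid_point k) =
      (K `&` coset L (@grid_point R d M k)) `&` grid M.
    apply/esym/setIidl => x [_ /LM xk]; rewrite -[x](subrK (grid_point k)).
    by apply: (periodic_groupD (periodic_grid M)) => //; exact: grid_grid_point.
  rewrite cnt_grid//; last by move=> x [] /K01.
  by rewrite -sum1_card big_mkcond; apply: eq_bigr => l _; rewrite inE /a; case: asboolP.
have colE l : (\sum_k a k l = n * `[< K (@grid_point R d M l) >])%N.
  rewrite -(card_translates (grid_grid_point (R := R) l)) -sum1_card.
  rewrite [in RHS]big_mkcond big_distrl/=.
  apply: eq_bigr => k _; rewrite inE /a.
  by case: asboolP => [[Kl Ll]|nKL]; case: asboolP => Ll'; case: asboolP => Kl' //=;
     exfalso; apply: nKL.
under eq_bigr do rewrite rowE; rewrite exchange_big/= cnt_grid//.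
under eq_bigr do rewrite colE; rewrite -big_distrr/=; congr (_ * _)%N.
by rewrite -sum1_card [LHS]big_mkcond; apply: eq_bigr => l _; rewrite inE; case: asboolP.
Qed.

(** The grid is a union of cosets of [L], so the density of grid points in [K] is
    an average of normalised counts over cosets. *)
Lemma equidistribution K (D : R) : K `<=` unit_cube ->
  (forall t, (cnt (K `&` coset L t))%:R <= (cnt (K `&` L))%:R + D) ->
  (forall t, (cnt (K `&` L))%:R <= (cnt (K `&` coset L t))%:R + D) ->
  `|(cnt (K `&` L))%:R / n%:R - (cnt (K `&` grid M))%:R / M%:R ^+ d| <= D / n%:R.
Proof.
move=> K01 upD loD; have n0 : 0 < n%:R :> R by rewrite ltr0n cnt_points_gt0.
have Md0 : 0 < M%:R ^+ d :> R by rewrite exprn_gt0// ltr0n.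
have sumE : n%:R * (cnt (K `&` grid M))%:R =
    \sum_(k : {ffun 'I_d -> 'I_M}) (cnt (K `&` coset L (@grid_point R d M k)))%:R :> R.
  by rewrite -natrM cnt_grid_sum// natr_sum.
have constE (c : R) : \sum_(k : {ffun 'I_d -> 'I_M}) c = M%:R ^+ d * c.
  by rewrite sumr_const card_ffun !card_ord -[_ *+ (_ ^ _)]mulr_natl natrX.
have up : n%:R * (cnt (K `&` grid M))%:R <= M%:R ^+ d * ((cnt (K `&` L))%:R + D).
  by rewrite sumE -constE; apply: ler_sum.
have lo : M%:R ^+ d * ((cnt (K `&` L))%:R - D) <= n%:R * (cnt (K `&` grid M))%:R.
  by rewrite sumE -constE; apply: ler_sum => k _; rewrite lerBlDr.
set G := (cnt (K `&` grid M))%:R in up lo *; set N := (cnt (K `&` L))%:R in up lo *.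
have GE : G / M%:R ^+ d = (n%:R * G) / M%:R ^+ d / n%:R.
  by rewrite [in RHS]mulrAC [n%:R * G]mulrC mulfK// gt_eqF.
have nV0 : 0 < n%:R^-1 :> R by rewrite invr_gt0.
rewrite GE -mulrBl normrM (gtr0_norm nV0) (ler_pM2r nV0) ler_norml; apply/andP; split.
  by rewrite lerBrDl lerBlDr ler_pdivrMr// [leRHS]mulrC.
rewrite lerBlDl -lerBlDr ler_pdivlMr// [leLHS]mulrC.
exact: lo.
Qed.
End count.

End equidistribution.

(** * The upper bound *)

Section lattice.
Context {R : realType} {d : nat}.
Implicit Types (A K L : set 'rV[R]_d) (x y t b h : 'rV[R]_d) (M : nat).

Lemma convex_in_cube_cvx K : convex_in_cube K -> cvx K.
Proof.
move=> [cK _] x y l Kx Ky /andP[l0 l1].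
by have := cK x y (Itv01 l0 l1) (mem_set Kx) (mem_set Ky) => /set_mem.
Qed.

Lemma cvx_convex K : cvx K -> K `<=` unit_cube -> convex_in_cube K.
Proof.
move=> cK K01; split=> // x y l /set_mem Kx /set_mem Ky; apply/mem_set.
by apply: cK => //; rewrite ge0 le1.
Qed.

Lemma unit_cube_box : unit_cube `<=` @box R d 0 1.
Proof. by move=> x x01 i; rewrite mxE add0r; exact: x01. Qed.

Section span.
Variable L : set 'rV[R]_d.
Hypotheses (perL : periodic_group L) (finP : finite_set (lattice_point_set L)).

Lemma cnt_span_shift K cs s t : cvx K -> K `<=` unit_cube ->
  (forall c, c \in cs -> L c) -> in_span cs t ->
  (cnt (K `&` coset L (s + t)))%:R
    <= (cnt (K `&` coset L s))%:R
       + (cnt (lattice_point_set L) * 2 ^ d)%:R * \sum_(c <- cs) norm2 c.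
Proof.
move=> cK K01; have Kbox : K `<=` box 0 1 by move=> x /K01/unit_cube_box.
elim: cs t => /= [t _ ->|c cs IH t csL [u tu]].
  by rewrite addr0 big_nil mulr0 addr0.
have -> : s + t = s + (t - u *: c) + u *: c by rewrite -addrA subrK.
have Lc : L c by apply: csL; rewrite mem_head.
apply: (le_trans (cnt_shift perL finP _ _ cK Kbox Lc)).
rewrite big_cons mulrDr [_ * norm2 c + _]addrC [leRHS]addrA lerD2r; apply: IH => //.
by move=> c' c'cs; apply: csL; rewrite in_cons c'cs orbT.
Qed.

Lemma cnt_coset_diff K cs t : cvx K -> K `<=` unit_cube ->
  (forall c, c \in cs -> L c) -> (forall x, in_span cs x) ->
  (cnt (K `&` coset L t))%:R <= (cnt (K `&` L))%:R
    + (cnt (lattice_point_set L) * 2 ^ d)%:R * \sum_(c <- cs) norm2 c /\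
  (cnt (K `&` L))%:R <= (cnt (K `&` coset L t))%:R
    + (cnt (lattice_point_set L) * 2 ^ d)%:R * \sum_(c <- cs) norm2 c.
Proof.
move=> cK K01 csL spanT; have := cnt_span_shift 0 cK K01 csL (spanT t).
have := cnt_span_shift t cK K01 csL (spanT (- t)).
by rewrite subrr add0r !coset0.
Qed.

(** Combines the comparison of [L] with the grids of mesh [1 / (N j)] and the
    approximation of the volume by these grids, for [j] tending to infinity. *)
Lemma lattice_discrepancy_le K cs N : cvx K -> K `<=` unit_cube ->
  (0 < N)%N -> L `<=` grid N ->
  (forall c, c \in cs -> L c) -> (forall x, in_span cs x) ->
  exists2 v : R, vol K = v%:E &
    `|(cnt (K `&` L))%:R / (cnt (lattice_point_set L))%:R - v|
      <= 2 ^+ d * \sum_(c <- cs) norm2 c.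
Proof.
move=> cK K01 N0 LN csL spanT; have [v vE vP] := vol_grid cK K01.
exists v => //; apply: (@le_harmonic _ _ _ (d%:R * 3 ^+ d)) => j j0.
have M0 : (0 < N * j)%N by rewrite muln_gt0 N0.
have LM : L `<=` grid (N * j).
  by move=> x /LN xN i; rewrite natrM mulrAC rpredM// rpred_nat.
have n0 : (cnt (lattice_point_set L))%:R != 0 :> R.
  by rewrite pnatr_eq0 -lt0n cnt_points_gt0.
have eq := equidistribution perL finP M0 LM K01
  (fun t => (cnt_coset_diff t cK K01 csL spanT).1)
  (fun t => (cnt_coset_diff t cK K01 csL spanT).2).
apply: le_trans (ler_distD ((cnt (K `&` grid (N * j)))%:R / (N * j)%:R ^+ d) _ _) _.
apply: lerD.
  by apply: (le_trans eq); rewrite natrM natrX -[X in X / _]mulrA [X in X / _]mulrC mulfK.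
rewrite distrC; apply: (le_trans (vP _ M0)); rewrite ler_wpM2l ?mulr_ge0 ?exprn_ge0//.
rewrite lef_pV2 ?posrE ?ltr0n// ler_nat; exact: leq_pmull.
Qed.
End span.

Lemma integration_lattice_periodic L : is_integration_lattice L -> periodic_group L.
Proof.
move=> [[B _ ->] ZL]; split => //.
  by exists (fun=> 0); rewrite big1// => i _; rewrite scale0r.
move=> _ _ [k ->] [l ->]; exists (fun i => k i - l i).
by rewrite -sumrB; apply: eq_bigr => i _; rewrite intrB scalerBl.
Qed.

(** Since [L] contains the unit vectors, the basis [B] of [L] is the inverse of an
    integer matrix; hence the determinant of the latter clears the denominators. *)
Lemma integration_lattice_grid L : is_integration_lattice L ->
  exists2 N, (0 < N)%N & L `<=` grid N.
Proof.
move=> [[B Bfree ->] ZL].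
have kP (i : 'I_d) : exists k : 'I_d -> int,
    delta_mx 0 i = \sum_j (k j)%:~R *: row j B by exact: ZL (@integer_delta _ _ i).
have [k kE] := choice kP.
pose Z : 'M[int]_d := \matrix_(i, j) k i j.
have ZB : map_mx intr Z *m B = 1%:M.
  apply/row_matrixP => i; rewrite row_mul row1 kE mulmx_sum_row.
  by apply: eq_bigr => j _; rewrite !mxE.
pose D := \det Z.
have D0 : D != 0.
  apply/eqP => D0; have := congr1 determinant ZB.
  by rewrite det_mulmx det_map_mx -/D D0 mul0r det1 => /esym/eqP; rewrite oner_eq0.
have DB : D%:~R *: B = map_mx intr (\adj Z).
  rewrite -[RHS]mulmx1 -ZB mulmxA -map_mxM mul_adj_mx -/D map_scalar_mx.
  by rewrite mul_scalar_mx.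
exists (absz D); first by rewrite absz_gt0.
move=> _ [c ->] i.
have -> : `|D|%N%:R = (Num.sg D)%:~R * D%:~R :> R.
  by rewrite -intrM -normrEsg.
rewrite -mulrA rpredM ?intr_int// summxE mulr_sumr rpred_sum// => j _.
have -> : D%:~R * ((c j)%:~R *: row j B) 0 i = (c j)%:~R * (D%:~R *: B) j i.
  by rewrite !mxE mulrCA.
by rewrite DB mxE rpredM// intr_int.
Qed.

Lemma dual_integer L h : integer_points `<=` L -> dual_lattice L h ->
  integer_points h.
Proof.
move=> ZL hL i; rewrite -dotv_delta; apply: hL; apply: ZL.
exact: integer_delta.
Qed.

Lemma integer_norm2_ge1 h : integer_points h -> h != 0 -> 1 <= norm2 h.
Proof.
move=> hZ /nonzero_coord[i hi].
by apply: le_trans (coord_le_norm2 h i); exact: norm_intr_ge1.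
Qed.

Lemma inv_dual_le_spectral L h : integer_points `<=` L ->
  dual_lattice L h -> h != 0 -> (norm2 h)^-1 <= spectral_test L.
Proof.
move=> ZL hL h0; rewrite /spectral_test; set S := [set norm2 h | h in _].
have Sh : S (norm2 h) by exists h => //; split => //=; exact/eqP.
have Slb : lbound S 1.
  move=> _ [h' [h'L /eqP h'0] <-]; apply: integer_norm2_ge1 => //.
  exact: dual_integer h'L.
have S1 : 1 <= inf S by apply: lb_le_inf => //; exists (norm2 h).
rewrite lef_pV2 ?posrE ?norm2_gt0//; last exact: lt_le_trans S1.
by apply: ge_inf => //; exists 1.
Qed.

(** The vectors of [dual_reduction] satisfy
    [norm2 c * norm2 h <= (4/3) ^ (d/2) <= 2 ^ d], and [(norm2 h)^-1] is at most
    the spectral test. *)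
Lemma short_vectors L : (0 < d)%N -> is_integration_lattice L ->
  exists cs, [/\ forall c, c \in cs -> L c, forall x, in_span cs x &
    \sum_(c <- cs) norm2 c <= d%:R * 2 ^+ d * spectral_test L].
Proof.
move=> d0 intL; have [L0 LB ZL] := integration_lattice_periodic intL.
have [N N0 LN] := integration_lattice_grid intL.
have dL : discrete_group L.
  by split => //; exists N => // x /LN xN i; rewrite mxE; exact: xN.
pose e := delta_mx 0 (Ordinal d0) : 'rV[R]_d.
have eL i : L (delta_mx 0 i).
  by apply: ZL; exact: integer_delta.
have e0 : e != 0.
  apply/eqP => /(congr1 (fun v : 'rV_d => v 0 (Ordinal d0))) /eqP.
  by rewrite !mxE !eqxx oner_eq0.
have [||cs [h [scs csP spanL [h0 _ hZ]]]] :=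
    @dual_reduction R d d L 1%:M e dL _ _ (eL _) e0.
- by rewrite mxrank1.
- by move=> x _; exact: submx1.
exists cs; split=> [c /csP[]//|x|].
  rewrite (row_sum_delta x); apply: (big_ind (in_span cs)) => //.
  - exact: in_span0.
  - exact: in_spanD.
  - by move=> i _; apply/in_spanZ/spanL.
have hs : (norm2 h)^-1 <= spectral_test L by apply: inv_dual_le_spectral.
have cle c : c \in cs -> norm2 c <= 2 ^+ d * spectral_test L.
  move=> /csP[_ _ cd]; apply: le_trans (ler_wpM2l _ hs) => //.
  rewrite ler_pdivlMr ?norm2_gt0// -(@ler_pXn2r _ 2) ?nnegrE ?mulr_ge0 ?norm2_ge0//.
  rewrite exprMn !sqr_norm2; apply: (le_trans cd).
  rewrite -exprM mulnC exprM ler_pXn2r ?nnegrE// ler_pdivrMr//.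
  by rewrite -natrX -natrM ler_nat.
have s0 : 0 <= 2 ^+ d * spectral_test L.
  by rewrite mulr_ge0//; apply: le_trans hs; rewrite invr_ge0 norm2_ge0.
rewrite -mulrA big_seq; apply: le_trans (ler_sum _ cle) _.
rewrite -big_seq big_const_seq count_predT iter_addr_0 -[_ *+ size cs]mulr_natl.
by rewrite ler_wpM2r// ler_nat.
Qed.

Lemma discrepancy_upper L n : (0 < d)%N -> is_integration_lattice L ->
  lattice_point_set L #= `I_n ->
  (isotropic_discrepancy n (lattice_point_set L)
    <= (d%:R * 2 ^+ (2 * (d + 1)) * spectral_test L)%:E)%E.
Proof.
move=> d0 intL Pn; have perL := integration_lattice_periodic intL.
have [N N0 LN] := integration_lattice_grid intL.
have finP : finite_set (lattice_point_set L).
  by rewrite (eq_finite_set Pn).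
have nE : cnt (lattice_point_set L) = n.
  have /fcard_eq := Pn.
  rewrite /cnt => ->; [|exact: finP|by []].
  rewrite fset_set_II card_imfset//=; last exact: val_inj.
  by rewrite -cardE card_ord.
have [cs [csL spanT sumcs]] := short_vectors d0 intL.
apply: ub_ereal_sup => _ [K Kc <-]; have cK := convex_in_cube_cvx Kc.
have [_ K01] := Kc.
have -> : K `&` lattice_point_set L = K `&` L.
  by apply/seteqP; split=> x [Kx]; [move=> []|split=> //; split => //; exact: K01].
have [v -> vP] := lattice_discrepancy_le perL finP cK K01 N0 LN csL spanT.
rewrite -EFinB/= lee_fin -/(cnt _) -nE; apply: (le_trans vP).
apply: (le_trans (ler_wpM2l _ sumcs)) => //.
have s0 : 0 <= d%:R * 2 ^+ d * spectral_test L.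
  by apply: le_trans sumcs; apply: sumr_ge0 => c _; exact: norm2_ge0.
have -> : d%:R * 2 ^+ (2 * (d + 1)) * spectral_test L =
    4 * (2 ^+ d * (d%:R * 2 ^+ d * spectral_test L)) :> R.
  by rewrite mulnDr exprD mul2n -addnn exprD; ring.
by rewrite ler_peMl ?ler1n// mulr_ge0.
Qed.
End lattice.

(** * The lower bounds *)

Section slabs.
Context {R : realType} {d : nat}.
Implicit Types (K L : set 'rV[R]_d) (x y h : 'rV[R]_d) (a z : int) (m M : nat).

Definition slab h a m : set 'rV[R]_d :=
  [set x | unit_cube x /\ a%:~R <= dotv h x <= a%:~R + m%:R].
Definition open_slab h a : set 'rV[R]_d :=
  [set x | unit_cube x /\ a%:~R < dotv h x < a%:~R + 1].

Lemma cvx_unit_cube : cvx (@unit_cube R d).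
Proof.
move=> x y l x01 y01 l01 i; rewrite !mxE.
have /andP[x0 x1] := x01 i; have /andP[y0 y1] := y01 i.
rewrite conv_lt// andbT; have /andP[l0 l1] := l01.
by rewrite addr_ge0// mulr_ge0// subr_ge0.
Qed.

Lemma cvx_slab h a m : cvx (slab h a m).
Proof.
move=> x y l [x01 /andP[hx hx']] [y01 /andP[hy hy']] l01; split.
  exact: cvx_unit_cube.
rewrite dotvDr !dotvZr; by rewrite conv_itv// ?hx ?hy.
Qed.

Lemma cvx_open_slab h a : cvx (open_slab h a).
Proof.
move=> x y l [x01 /andP[hx hx']] [y01 /andP[hy hy']] l01; split.
  exact: cvx_unit_cube.
rewrite dotvDr !dotvZr conv_lt// andbT -ltrN2 opprD -!mulrN conv_lt//; by rewrite ltrN2.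
Qed.

(** Every point of a hyperplane is the end of its line in a direction that is not
    parallel to the hyperplane. *)
Lemma cnt_hyperplane h a M : (0 < M)%N -> h != 0 ->
  (cnt (slab h a 0 `&` grid M))%:R <= M%:R ^+ d * 2 ^+ d / M%:R :> R.
Proof.
move=> M0 /nonzero_coord[i hi]; have finM := @finite_grid_cube R d M M0.
have sbox : slab h a 0 `<=` box 0 1 by move=> x [/unit_cube_box].
have := cnt_ends (periodic_grid M) finM 0 (@cvx_slab h a 0) sbox (grid_unitM M0 i).
rewrite norm2_unitM// cnt_grid_cube// coset0 natrM !natrX.
congr ((cnt _)%:R <= _); apply/seteqP; split=> [x []//|x [sx xM]]; split => //.
move=> [_]; case: sx => _; rewrite !addr0 dotvDr => /andP[h1 h2] /andP[h3 h4].
have : dotv h (unitM M i) = 0 by lra.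
rewrite dotvZr dotv_delta => /eqP.
by rewrite mulf_eq0 (negPf hi) orbF invr_eq0 pnatr_eq0 -leqn0 leqNgt M0.
Qed.

Lemma cnt_slab h a m M (s t : R) : (0 < M)%N ->
  (forall a, (cnt (open_slab h a `&` grid M))%:R <= s) ->
  (forall a, (cnt (slab h a 0 `&` grid M))%:R <= t) ->
  (cnt (slab h a m `&` grid M))%:R <= m%:R * s + m.+1%:R * t.
Proof.
move=> M0 hs ht.
have finS a' m' : finite_set (slab h a' m' `&` grid M).
  by apply: finite_grid => // x [].
have finO a' : finite_set (open_slab h a' `&` grid M).
  by apply: finite_grid => // x [].
elim: m => [|m IH]; first by rewrite mul0r add0r mul1r.
have sub : slab h a m.+1 `&` grid M `<=`
    ((slab h a m `&` grid M) `|` (open_slab h (a + m%:Z) `&` grid M))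
    `|` (slab h (a + m.+1%:Z) 0 `&` grid M).
  move=> x [[x01 /andP[h1 h2]] xM].
  have amE k : (a + k%:Z)%:~R = a%:~R + k%:R :> R by rewrite intrD.
  have mS : m.+1%:R = m%:R + 1 :> R by rewrite natr1.
  have [le1|lt1] := leP (dotv h x) (a%:~R + m%:R).
    by left; left; split => //; split => //; rewrite h1.
  have [lt2|ge2] := ltP (dotv h x) (a%:~R + m.+1%:R).
    left; right; split => //; split => //; rewrite amE lt1/=.
    by rewrite -addrA -mS.
  by right; split => //; split => //; rewrite amE addr0 ge2 h2.
have := cnt_le _ sub.
rewrite !finite_setU => /(_ (conj (conj (finS _ _) (finO _)) (finS _ _))).
have finU : finite_set ((slab h a m `&` grid M) `|` (open_slab h (a + m%:Z) `&` grid M)).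
  by rewrite finite_setU.
move/leq_trans => /(_ _ (cntU finU (finS _ _))).
have := cntU (finS a m) (finO (a + m%:Z)).
rewrite -(leq_add2r (cnt (slab h (a + m.+1%:Z) 0 `&` grid M))) => h1 h2.
have := leq_trans h2 h1; rewrite -(ler_nat R) !natrD => h3.
have := hs (a + m%:Z); have := ht (a + m.+1%:Z).
rewrite -[m.+2%:R]natr1 -[m.+1%:R]natr1; rewrite -[m.+1%:R]natr1 in IH.
move: h3 IH; lra.
Qed.

(** If every open slab has volume at most [D], then so has, on average, each of the
    [m] unit slabs forming a slab of width [m], up to a term that vanishes as the
    grid is refined: the [m + 1] hyperplanes between them carry few grid points. *)
Lemma slab_density h a m M (D : R) : (0 < M)%N -> h != 0 ->
  (forall a v, vol (open_slab h a) = v%:E -> v <= D) ->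
  (cnt (slab h a m `&` grid M))%:R / M%:R ^+ d
    <= m%:R * D + (m%:R * (d%:R * 3 ^+ d) + m.+1%:R * 2 ^+ d) / M%:R.
Proof.
move=> M0 h0 hD; have M0' : 0 < M%:R :> R by rewrite ltr0n.
have Md0 : 0 < M%:R ^+ d :> R by rewrite exprn_gt0.
have := @cnt_slab h a m M (M%:R ^+ d * (D + d%:R * 3 ^+ d / M%:R))
  (M%:R ^+ d * 2 ^+ d / M%:R) M0 _ (fun a => cnt_hyperplane a M0 h0).
have slabD a' : (cnt (open_slab h a' `&` grid M))%:R
    <= M%:R ^+ d * (D + d%:R * 3 ^+ d / M%:R).
  have s01 : open_slab h a' `<=` unit_cube by move=> x [].
  have [v vE vP] := vol_grid (@cvx_open_slab h a') s01.
  have := hD a' v vE; have := vP M M0; rewrite ler_norml => /andP[h1 _] h2.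
  by rewrite mulrC -ler_pdivrMr//; lra.
move/(_ slabD) => h1; rewrite ler_pdivrMr//; apply: (le_trans h1).
rewrite le_eqVlt; apply/orP; left; apply/eqP; field.
by rewrite gt_eqF.
Qed.

Section dual.
Variables (h : 'rV[R]_d) (D : R).
Hypotheses (hZ : integer_points h) (h0 : h != 0).
Hypothesis hD : forall a v, vol (open_slab h a) = v%:E -> v <= D.

Lemma cauchy_sum_abs : (\sum_i `|h 0 i|) ^+ 2 <= d%:R * dotv h h.
Proof.
set s := \sum_i _.
have : 0 <= \sum_i (d%:R * `|h 0 i| - s) ^+ 2 by apply: sumr_ge0 => i _; exact: sqr_ge0.
have -> : \sum_i (d%:R * `|h 0 i| - s) ^+ 2 = d%:R * (d%:R * dotv h h - s ^+ 2).
  transitivity (\sum_i (d%:R ^+ 2 * (h 0 i * h 0 i) - 2 * d%:R * s * `|h 0 i| + s ^+ 2)).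
    apply: eq_bigr => i _; rewrite -expr2 -[h 0 i ^+ 2]real_normK ?num_real//; ring.
  rewrite big_split sumrB -!mulr_sumr -/(dotv h h) -/s sumr_const card_ord/= -mulr_natl.
  by ring.
have [d0|d0] := posnP d.
  move=> _; rewrite /s big1 ?expr0n/= ?mulr_ge0 ?dotv_ge0// => i _.
  by have := leq_trans (ltn_ord i) (eq_leq d0).
by rewrite pmulr_rge0 ?ltr0n// subr_ge0.
Qed.

Lemma sum_abs_le : \sum_i `|h 0 i| <= Num.sqrt d%:R * norm2 h.
Proof.
rewrite /norm2 -sqrtrM// -[leLHS]ger0_norm ?sumr_ge0// -sqrtr_sqr.
by rewrite ler_wsqrtr// cauchy_sum_abs.
Qed.

(** The linear form [dotv h] has integer coefficients, so its range on the unit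
    cube is contained in an interval with integer end points of length
    [\sum_i `|h 0 i|]: the cube is one slab of this width. *)
Lemma inv_sqrt_dual_le : 1 <= Num.sqrt d%:R * norm2 h * D.
Proof.
have zP i : exists z : int, h 0 i = z%:~R by apply/intrP; exact: hZ.
have [z zE] := choice zP.
pose m := (\sum_i `|z i|)%N.
pose a := \sum_i (if z i < 0 then z i else 0).
have mE : m%:R = \sum_i `|h 0 i| :> R.
  rewrite /m natr_sum; apply: eq_bigr => i _; rewrite zE -intr_norm.
  by rewrite -abszE.
have cubeE : slab h a m = unit_cube.
  apply/seteqP; split=> [x []//|x x01]; split => //.
  have aE : a%:~R = \sum_i (if h 0 i < 0 then h 0 i else 0).
    rewrite /a raddf_sum; apply: eq_bigr => i _; rewrite zE ltrz0.
    by case: ifP.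
  rewrite aE mE -big_split; apply/andP; split; apply: ler_sum => i _.
    have /andP[x0 x1] := x01 i; case: ltP => hi; nra.
  have /andP[x0 x1] := x01 i; case: ltP => hi /=.
    by rewrite ltr0_norm//; nra.
  by rewrite ger0_norm//; nra.
have : 1 <= m%:R * D.
  apply: (@le_harmonic _ _ _ (m%:R * (d%:R * 3 ^+ d) + m.+1%:R * 2 ^+ d)) => M M0.
  have := @slab_density h a m M D M0 h0 hD; rewrite cubeE setIC.
  rewrite cnt_grid_cube// natrX divff//.
  by rewrite expf_neq0// pnatr_eq0 -lt0n.
move=> mD; have m0 : 0 <= m%:R :> R by [].
have D0 : 0 <= D by rewrite leNgt; apply/negP => D0; nra.
by apply: (le_trans mD); rewrite ler_wpM2r// mE sum_abs_le.
Qed.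

Section variance.
Variable M : nat.
Hypothesis M0 : (0 < M)%N.
Notation idx := {ffun 'I_d -> 'I_M}.

(** The coordinate of a grid point in the cube, minus the mean over the grid. *)
Definition centered (j : 'I_M) : R := j%:R / M%:R - (M%:R - 1) / (2 * M%:R).

Let M0' : 0 < M%:R :> R. Proof. by rewrite ltr0n. Qed.

Lemma centered_rev j : centered (rev_ord j) = - centered j.
Proof.
rewrite /centered /= natrB; last exact: ltn_ord.
rewrite -natr1; field; exact/lt0r_neq0.
Qed.

Lemma centered_sqr j : centered j ^+ 2 <= 4^-1.
Proof.
have jM : j%:R + 1 <= M%:R :> R by rewrite natr1 ler_nat ltn_ord.
have : `|centered j| <= 2^-1.
  have cE : centered j = (2 * j%:R - (M%:R - 1)) / (2 * M%:R).
    by rewrite /centered; field; exact/lt0r_neq0.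
  have j0 : 0 <= j%:R :> R by [].
  rewrite cE ler_norml ler_pdivlMr ?mulr_gt0// ler_pdivrMr ?mulr_gt0//.
  by rewrite !mulrA mulVf// !mulNr mulVf//; apply/andP; split; lra.
rewrite -(@ler_pXn2r _ 2) ?nnegrE// real_normK ?num_real//.
by move/le_trans; apply; rewrite exprVn -natrX.
Qed.

(** Reflecting the [i]-th coordinate changes the sign of every summand. *)
Lemma centered_cross (i j : 'I_d) : i != j ->
  \sum_(k : idx) centered (k i) * centered (k j) = 0.
Proof.
move=> ij; pose flip (k : idx) : idx :=
  [ffun l => if l == i then rev_ord (k l) else k l].
have flipK : involutive flip.
  move=> k; apply/ffunP => l; rewrite !ffunE; case: eqP => // _; exact: rev_ordK.
set S := \sum_k _.
have : S = - S.
  rewrite {1}/S (reindex_inj (inv_inj flipK)) -sumrN; apply: eq_bigr => k _.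
  by rewrite !ffunE eqxx eq_sym (negPf ij) centered_rev mulNr.
by move=> SN; lra.
Qed.

Lemma second_moment : \sum_(k : idx) (\sum_i h 0 i * centered (k i)) ^+ 2
  <= M%:R ^+ d * (dotv h h / 4).
Proof.
have -> : \sum_(k : idx) (\sum_i h 0 i * centered (k i)) ^+ 2 =
    \sum_i h 0 i * h 0 i * \sum_(k : idx) centered (k i) ^+ 2.
  under eq_bigr do rewrite expr2 mulr_suml; rewrite exchange_big/=.
  apply: eq_bigr => i _.
  under eq_bigr do rewrite mulr_sumr; rewrite exchange_big/= (bigD1 i)//=.
  rewrite [X in _ + X]big1 => [|j ji]; last first.
    have := @centered_cross i j; rewrite eq_sym => /(_ ji) c0.
    transitivity (h 0 i * h 0 j * \sum_(k : idx) centered (k i) * centered (k j)).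
      by rewrite mulr_sumr; apply: eq_bigr => k _; ring.
    by rewrite c0 mulr0.
  by rewrite addr0 mulr_sumr; apply: eq_bigr => k _; ring.
rewrite /dotv mulr_suml mulr_sumr; apply: ler_sum => i _.
rewrite mulrCA -expr2 ler_wpM2l ?sqr_ge0//.
apply: (@le_trans _ _ (\sum_(k : idx) 4^-1)).
  by apply: ler_sum => k _; exact: centered_sqr.
by rewrite sumr_const card_ffun !card_ord -[_ *+ (_ ^ _)]mulr_natl natrX.
Qed.

(** Chebyshev's inequality for the uniform distribution on the grid: the
    variance of [dotv h] is at most [dotv h h / 4], independently of the
    dimension. *)
Lemma concentration : exists mu : R,
  M%:R ^+ d * (3 / 4) <=
    #|[pred k : idx | `|dotv h (@grid_point R d M k) - mu| <= norm2 h]|%:R :> R.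
Proof.
pose mu := \sum_i h 0 i * ((M%:R - 1) / (2 * M%:R)); exists mu.
have cE k : dotv h (@grid_point R d M k) - mu = \sum_i h 0 i * centered (k i).
  by rewrite -sumrB; apply: eq_bigr => i _; rewrite mxE /centered mulrBr.
set P := [pred k | _].
have hh : 0 < dotv h h by rewrite dotv_gt0.
have bad : #|[predC P]|%:R * dotv h h <= M%:R ^+ d * (dotv h h / 4).
  apply: le_trans second_moment.
  rewrite -sum1_card natr_sum mulr_suml big_mkcond/=; apply: ler_sum => k _.
  rewrite mul1r -cE; case: ifPn => [|_]; last exact: sqr_ge0.
  rewrite !inE -ltNge => hk; rewrite -sqr_norm2 -[leRHS]real_normK ?num_real//.
  by rewrite ler_pXn2r ?nnegrE ?norm2_ge0// ltW.
have : #|[predC P]|%:R <= M%:R ^+ d / 4 :> R.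
  by rewrite -(ler_pM2r hh) mulrAC -mulrA.
have := cardC P; rewrite card_ffun !card_ord => /(congr1 (fun n => n%:R : R)).
by rewrite natrD natrX => <-; lra.
Qed.
End variance.

(** Three quarters of the cube are covered by [m <= 4 * norm2 h] slabs, so some
    open slab has volume at least [3 / (16 * norm2 h)]. *)
Lemma inv_dual_le : 3 / 16 <= norm2 h * D.
Proof.
have h1 : 1 <= norm2 h by exact: integer_norm2_ge1.
(* slabs between integers cover any interval of length 2 * norm2 h once their
   number exceeds this length by 1, and 2 <= 2 * norm2 h *)
have [q qE] : exists q : nat, Num.floor (2 * norm2 h) = q%:Z.
  exists (absz (Num.floor (2 * norm2 h))); rewrite gez0_abs//.
  by rewrite floor_ge0 mulr_ge0// norm2_ge0.
pose m := q.+2.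
have m2 : 2 * norm2 h + 1 <= m%:R <= 2 * norm2 h + 2.
  have := floor_itv (2 * norm2 h); rewrite qE intrD => /andP[f1 f2].
  by rewrite /m -addn2 natrD; apply/andP; split; lra.
have : 3 / 4 <= m%:R * D.
  apply: (@le_harmonic _ _ _ (m%:R * (d%:R * 3 ^+ d) + m.+1%:R * 2 ^+ d)) => M M0.
  have [mu muP] := concentration M0.
  pose a := Num.floor (mu - norm2 h).
  apply: le_trans (@slab_density h a m M D M0 h0 hD).
  rewrite ler_pdivlMr ?exprn_gt0 ?ltr0n// mulrC; apply: (le_trans muP).
  rewrite ler_nat cnt_grid//; last by move=> x [].
  apply/subset_leq_card/fintype.subsetP => k; rewrite !inE => hk.
  split; first exact: unit_cube_grid_point.
  have := floor_itv (mu - norm2 h); rewrite -/a intrD => /andP[a1 a2].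
  move: hk; rewrite ler_norml => /andP[k1 k2].
  by apply/andP; split; lra.
move=> mD; have /andP[_ m4] := m2.
have D0 : 0 <= D.
  by rewrite leNgt; apply/negP => D0; have : 0 <= m%:R :> R by []; nra.
nra.
Qed.

End dual.

Lemma spectral_test_le L (C D : R) : 0 < C -> 0 <= D ->
  (forall h, dual_lattice L h -> h != 0 -> C <= norm2 h * D) ->
  0 <= spectral_test L /\ C * spectral_test L <= D.
Proof.
move=> C0 D0 hC; rewrite /spectral_test; set S := [set norm2 h | h in _].
have Dh h : dual_lattice L h -> h != 0 -> 0 < D.
  move=> hL h0; have := hC h hL h0; have := norm2_ge0 h; nra.
have [S0|/set0P[s0 Ss0]] := eqVneq S set0.
  (* an empty infimum is 0, and so is its inverse *)
  by rewrite S0 inf0 invr0 mulr0.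
have [h [hL /eqP h0] _] := Ss0.
have Dgt := Dh h hL h0.
have CS : C / D <= inf S.
  apply: lb_le_inf; first by exists s0.
  move=> _ [h' [h'L /eqP h'0] <-]; rewrite ler_pdivrMr//; exact: hC.
have S0 : 0 < inf S by apply: lt_le_trans CS; rewrite divr_gt0.
split; first by rewrite invr_ge0 ltW.
by rewrite ler_pdivrMr// mulrC -ler_pdivrMr.
Qed.

(** The points of [L] lie on the hyperplanes where [dotv h] is an integer, so the
    open slabs are convex sets without lattice points and their volumes are
    lower bounds for the discrepancy. *)
Lemma discrepancy_lower L n : (0 < d)%N -> is_integration_lattice L ->
  ((spectral_test L / (Num.sqrt d%:R + spectral_test L))%:E
     <= isotropic_discrepancy n (lattice_point_set L) /\
   (3 / 16 * spectral_test L)%:E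
     <= isotropic_discrepancy n (lattice_point_set L))%E.
Proof.
move=> d0 intL; have [_ _ ZL] := integration_lattice_periodic intL.
have ge0 : (0 <= isotropic_discrepancy n (lattice_point_set L))%E.
  apply: le_trans (ereal_sup_ubound _); last first.
    by exists set0; [apply: cvx_convex|].
  exact: abse_ge0.
case DE : isotropic_discrepancy ge0 => [D||] //; last by rewrite !leey.
rewrite !lee_fin => D0.
have volD K v : convex_in_cube K -> K `&` L = set0 -> vol K = v%:E -> v <= D.
  move=> Kc KL vE; rewrite -lee_fin -DE -vE.
  apply: le_trans (ereal_sup_ubound _); last by exists K.
  have -> : K `&` lattice_point_set L = set0.
    by apply/seteqP; split=> // x [Kx [Lx _]]; rewrite -KL.
  by rewrite fset_set0 cardfs0 mul0r add0e abseN gee0_abs// vol_ge0.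
have slabD h : dual_lattice L h -> forall a v, vol (open_slab h a) = v%:E -> v <= D.
  move=> hL a v; apply: volD; first by apply: cvx_convex; [exact: cvx_open_slab|move=> x []].
  apply/seteqP; split=> // x [[_ /andP[h1 h2]] Lx].
  have /intrP[z zE] := hL x Lx; move: h1 h2.
  by rewrite zE -[1]/(1%:~R) -intrD !ltr_int; lia.
have sqrtd : 0 < Num.sqrt d%:R :> R by rewrite sqrtr_gt0 ltr0n.
have [s0 s1] : 0 <= spectral_test L /\ (Num.sqrt d%:R)^-1 * spectral_test L <= D.
  apply: spectral_test_le => // [|h hL h0]; first by rewrite invr_gt0.
  rewrite -[_^-1]mul1r ler_pdivrMr// mulrC mulrA.
  apply: inv_sqrt_dual_le => //; [exact: dual_integer hL|exact: slabD].
have [_ s2] : 0 <= spectral_test L /\ 3 / 16 * spectral_test L <= D.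
  apply: spectral_test_le => // h hL h0.
  apply: inv_dual_le => //; [exact: dual_integer hL|exact: slabD].
split=> //; apply: le_trans s1; rewrite mulrC ler_wpM2r//.
by rewrite lef_pV2 ?posrE ?ltr_pwDl// lerDl.
Qed.

End slabs.

Theorem theorem6p5 (R : realType) :
  (forall (d n : nat) (L : set 'rV[R]_d),
     (2 <= d)%N ->
     is_integration_lattice L ->
     lattice_point_set L #= `I_n ->
     ((spectral_test L / (Num.sqrt d%:R + spectral_test L))%:E
        <= isotropic_discrepancy n (lattice_point_set L)
        <= (d%:R * 2 ^+ (2 * (d + 1)) * spectral_test L)%:E)%E) /\
  (exists2 c : R, 0 < c &
     forall (d n : nat) (L : set 'rV[R]_d),
     (2 <= d)%N ->
     is_integration_lattice L ->
     lattice_point_set L #= `I_n ->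
     spectral_test L <= 1 / 2 ->
     ((c * spectral_test L)%:E
        <= isotropic_discrepancy n (lattice_point_set L))%E).
Proof.
split=> [d n L d2 intL Pn|].
  have d0 : (0 < d)%N by exact: ltnW.
  rewrite discrepancy_upper// andbT.
  by have [] := discrepancy_lower n d0 intL.
exists (3 / 16) => [|d n L d2 intL _ _]; first exact: divr_gt0.
by have [] := discrepancy_lower n (ltnW d2) intL.
Qed.
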